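(* $\mathrm{SCM}(4,3;4;7,2,6)=\mathrm{RE}$. That is, a language is recursively enumerable if and only if it is generated by an SCM grammar with all of the following properties: - degree $(4,3)$; - at most $4$ nonterminals; - at most $7$ conditional matrices; - all matrices of length at most $2$; - at most $6$ non-simple matrices.
   Context: A semi-conditional matrix (SCM) grammar is a quadruple $G=(V,T,M,S)$ with the following components. - $V$ is a finite alphabet and $T\subsetneq V$ is the set of terminals. - $N=V\setminus T$ is the set of nonterminals and $S\in N$ is the start symbol. - $M$ is a finite set of matrices of the form $r=[(A_1\to x_1),\dots,(A_\ell\to x_\ell),P,F]$, where $\ell\ge 1$, $A_k\in N$, $x_k\in V^*$, and $P,F\in V^+\cup\{\emptyset\}$. Here $\emptyset\notin V$ is a special symbol meaning that the condition is absent, and $|\emptyset|=0$. The number $\ell$ is the length of $r$. A matrix is classified as follows: - unconditional if $P=F=\emptyset$, and conditional otherwise; - simple if at least one of $P,F$ equals $\emptyset$, and non-simple if both $P\neq\emptyset$ and $F\neq\emptyset$. For $x,y\in V^*$ we write $x\Rightarrow_r y$ iff all of the following hold: 1. if $P\neq\emptyset$ then $P$ is a subword (factor) of $x$; 2. if $F\neq\emptyset$ then $F$ is not a subword of $x$; 3. there are words $x=y_0,y_1,\dots,y_\ell=y$ such that $y_k$ is obtained from $y_{k-1}$ by replacing one occurrence of $A_k$ by $x_k$. $\Rightarrow_G$ is the union of the relations $\Rightarrow_r$ over $r\in M$, and $L(G)=\{y\in T^*: S\Rightarrow_G^* y\}$. $G$ has degree $(i,j)$ if every matrix satisfies $|P|\le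 i$ and $|F|\le j$. $\mathrm{SCM}(i,j;n;m,\ell,s)$ denotes the family of languages $L(G)$ of SCM grammars $G$ that satisfy all of the following: - $G$ has degree $(i,j)$; - $|N|\le n$; - $G$ has at most $m$ conditional matrices; - every matrix of $G$ has length at most $\ell$; - $G$ has at most $s$ non-simple matrices. A $*$ in a parameter position means that parameter is unbounded. $\mathrm{SSCM}(i,j;n;m,\ell)=\mathrm{SCM}(i,j;n;m,\ell,0)$, i.e., all matrices are simple. $\mathrm{RE}$ is the class of recursively enumerable languages. *)

(* Defs.v *)
From Stdlib Require Import Relations.Relation_Operators.
From mathcomp Require Import all_boot.
Set Implicit Arguments. Unset Strict Implicit. Unset Printing Implicit Defensive.

Definition symbol := nat.
Definition word := seq symbol.
Definition language := word -> Prop.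

Definition word_over (A : seq symbol) (w : word) : bool := all (fun a => a \in A) w.

(* "Condition absent" (the special symbol emptyset) is [None]. *)
Definition cond := option word.

(* A matrix [(A_1 -> x_1), ..., (A_l -> x_l), P, F]. *)
Definition matrix : Type := (seq (symbol * word) * (cond * cond))%type.
Definition mrules (r : matrix) : seq (symbol * word) := r.1.
Definition mP (r : matrix) : cond := r.2.1.
Definition mF (r : matrix) : cond := r.2.2.

Record scm_grammar := SCM {
  scm_V : seq symbol;
  scm_T : seq symbol;
  scm_S : symbol;
  scm_M : seq matrix }.

Definition scm_N (G : scm_grammar) : seq symbol :=
  [seq a <- scm_V G | a \notin scm_T G].

Definition cond_ok (V : seq symbol) (c : cond) : bool :=
  if c is Some p then (p != [::]) && word_over V p else true.

Definition scm_wf (G : scm_grammar) : Prop :=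
  uniq (scm_V G) /\ uniq (scm_T G) /\
      all (fun a => a \in scm_V G) (scm_T G) /\
      has (fun a => a \notin scm_T G) (scm_V G) /\
      scm_S G \in scm_N G /\
      uniq (scm_M G) /\
      all (fun r =>
             [&& mrules r != [::],
                 all (fun Ax => (Ax.1 \in scm_N G) && word_over (scm_V G) Ax.2) (mrules r),
                 cond_ok (scm_V G) (mP r) & cond_ok (scm_V G) (mF r)]) (scm_M G).

Definition rule_step (Aw : symbol * word) (x y : word) : Prop :=
  exists u v, x = u ++ Aw.1 :: v /\ y = u ++ Aw.2 ++ v.

Fixpoint rules_apply (rs : seq (symbol * word)) (x y : word) : Prop :=
  match rs with
  | [::] => x = y
  | r :: rs' => exists z, rule_step r x z /\ rules_apply rs' z y
  end.

Definition matrix_step (r : matrix) (x y : word) : Prop :=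
  [/\ (forall p, mP r = Some p -> infix p x),
      (forall f, mF r = Some f -> ~~ infix f x) &
      rules_apply (mrules r) x y].

Definition scm_step (G : scm_grammar) (x y : word) : Prop :=
  exists2 r, r \in scm_M G & matrix_step r x y.

Definition scm_lang (G : scm_grammar) : language :=
  fun w => word_over (scm_T G) w /\ clos_refl_trans _ (scm_step G) [:: scm_S G] w.

Definition csize (c : cond) : nat := if c is Some p then size p else 0.
Definition conditional (r : matrix) : bool := (mP r != None) || (mF r != None).
Definition nonsimple (r : matrix) : bool := (mP r != None) && (mF r != None).

Definition in_SCM (i j n m l s : nat) (L : language) : Prop :=
  exists G : scm_grammar,
    scm_wf G /\
    all (fun r => (csize (mP r) <= i) && (csize (mF r) <= j)) (scm_M G) /\
    size (scm_N G) <= n /\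
    count conditional (scm_M G) <= m /\
    all (fun r => size (mrules r) <= l) (scm_M G) /\
    count nonsimple (scm_M G) <= s /\
    (forall w, L w <-> scm_lang G w).

(* Recursively enumerable languages: the languages generated by
   phrase-structure (type-0, unrestricted) grammars. *)
Record ps_grammar := PSG {
  ps_V : seq symbol;
  ps_T : seq symbol;
  ps_S : symbol;
  ps_P : seq (word * word) }.

Definition ps_N (G : ps_grammar) : seq symbol :=
  [seq a <- ps_V G | a \notin ps_T G].

Definition ps_wf (G : ps_grammar) : Prop :=
  [/\ all (fun a => a \in ps_V G) (ps_T G),
      ps_S G \in ps_N G &
      all (fun uv => [&& word_over (ps_V G) uv.1,
                         has (fun a => a \in ps_N G) uv.1 &
                         word_over (ps_V G) uv.2]) (ps_P G)].

Definition ps_step (G : ps_grammar) (x y : word) : Prop :=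
  exists2 uv, uv \in ps_P G &
    exists a b, x = a ++ uv.1 ++ b /\ y = a ++ uv.2 ++ b.

Definition ps_lang (G : ps_grammar) : language :=
  fun w => word_over (ps_T G) w /\ clos_refl_trans _ (ps_step G) [:: ps_S G] w.

Definition is_RE (L : language) : Prop :=
  exists G : ps_grammar, ps_wf G /\ forall w, L w <-> ps_lang G w.

(* Main.v *)
From Stdlib Require Import Relations.Relation_Operators Classical.
Require Import Defs.
From mathcomp Require Import all_boot zify.
Set Implicit Arguments. Unset Strict Implicit. Unset Printing Implicit Defensive.

(** A type-0 derivation of [w] is recorded, backwards, as a history
    [w # x_n # ... # x_0]; its validity is a Post correspondence
    between two token sequences that produce this history with a shift of one
    sentential form.  The SCM grammar generates the codes of the two sequences,
    one of them mirrored, on both sides of a marker [D D]: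
    [... A B^i A B^i' D D B^j' A B^j A ...], followed by the generated word.
    Exponents are 1 or 2.  Two facing blocks can be erased unless [i = j = 1], and
    facing letters [A] are erased together.  One-hot codes, complementary
    on the two sides, make all pairs of blocks erasable exactly when the token
    sequences agree.

    Erasing [B] by [D -> ], [B -> D] is self-checking: if the rewritten [B] is not
    adjacent to the marker, the two [D]s are separated for ever and the adjacent
    [B] survives, because the matrices acting on [B] need the factor [D D].  The matrix rewriting both [A]s to [D]
    is checked by the factor [D D D D]; the forbidden factor [B D] shows the
    misplaced [D]s.

    Conversely, a machine whose head is a nonterminal of a type-0 grammar
    looks up the permitting word, scans for the forbidden one, and then applies
    the rules of a matrix. *)

(** * Factors and applications of single rules *)

(** The number of unconditional matrices is not bounded, so everything specific to the language goes
    into rules for [S]; the seven conditional matrices act on [A], [B], [D] only and are the same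
    for every language. The obstacle is that conditions are tested only on the word before a matrix,
    while its rules may then hit any occurrence of their left-hand sides. A wrong choice thus shows
    only afterwards, and soundness amounts to proving that each one leaves a nonterminal that no
    later matrix can remove. Exponents are never 0, because a misplaced [D] is recognised by the
    [B]s around it. A history starts with at least one generated letter, so the empty word gets a
    rule of its own. *)

Section Factors.
Variable T : eqType.
Implicit Types (a b p w : seq T) (d : T).

Lemma prefix_cut d a b p w : d \notin a -> d \notin p ->
  prefix (a ++ d :: b) (p ++ d :: w) = (a == p) && prefix b w.
Proof.
elim: a p => [|x a IHa] [|y p] /=; rewrite ?inE ?negb_or.
- by rewrite eqxx.
- by move=> _ /andP[/negbTE->].
- by rewrite eq_sym => /andP[/negbTE->].
- move=> /andP[_ da] /andP[_ dp]; rewrite IHa // eqseq_cons.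
  by rewrite andbA.
Qed.

Lemma suffix_consl a x p : suffix a (x :: p) = (a == x :: p) || suffix a p.
Proof.
apply/suffixP/orP => [[[|y s] /= e]|[/eqP->|/suffixP[s ->]]].
- by left; rewrite e.
- by case: e => _ ->; right; exact: suffix_suffix.
- by exists [::].
- by exists (x :: s).
Qed.

(** The first [d] of the pattern meets either the displayed [d] or one inside [w], and [a] is free
    of [d]. Used as a rewrite rule, this decides factors by going from one [d] to the next. *)
Lemma infix_cut d a b p w : d \notin a -> d \notin p ->
  infix (a ++ d :: b) (p ++ d :: w) =
  (suffix a p && prefix b w) || infix (a ++ d :: b) w.
Proof.
move=> da; elim: p => [|x p IHp].
  case: a da => [|y a] da /=; first by rewrite eqxx.
  by move: da; rewrite suffixs0 inE negb_or eq_sym => /andP[/negbTE-> _].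
move=> dxp; have := dxp; rewrite inE negb_or => /andP[dx dp].
rewrite cat_cons infix_consl IHp // suffix_consl -cat_cons prefix_cut //.
by rewrite andb_orl orbA.
Qed.

Lemma infix_cut0 d a b w : d \notin a ->
  infix (a ++ d :: b) (d :: w) =
  ((a == [::]) && prefix b w) || infix (a ++ d :: b) w.
Proof. by move=> da; rewrite -[d :: w]cat0s infix_cut // suffixs0. Qed.

Lemma prefix_notin d a p : d \notin p -> prefix (d :: a) p = false.
Proof.
by case: p => //= x p; rewrite inE negb_or => /andP[/negbTE-> _].
Qed.

Lemma infix_notin d a b p : d \notin p -> infix (a ++ d :: b) p = false.
Proof.
move=> dp; apply/negP => /infixP[s [t e]].
by move: dp; rewrite e !mem_cat inE eqxx !orbT.
Qed.

Lemma infix_count2 d w : infix [:: d; d] w -> 1 < count_mem d w.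
Proof. by case/infixP=> s [t ->]; rewrite !count_cat /= eqxx; lia. Qed.

End Factors.

Lemma cat_eq_mid (T : Type) (u v x y : seq T) c : u ++ v = x ++ c :: y ->
  (exists2 t, u = x ++ c :: t & y = t ++ v) \/
  (exists2 t, x = u ++ t & v = t ++ c :: y).
Proof.
elim: u x => [|d u IHu] [|b x] /=.
- by move=> ->; right; exists [::].
- by move=> ->; right; exists (b :: x).
- by move=> [-> <-]; left; exists u.
- move=> [-> /IHu[[t -> ->]|[t -> ->]]]; first by left; exists t.
  by right; exists t.
Qed.

Lemma all2_cat (T U : Type) (r : T -> U -> bool) s1 s2 t1 t2 :
  size s1 = size t1 ->
  all2 r (s1 ++ s2) (t1 ++ t2) = all2 r s1 t1 && all2 r s2 t2.
Proof.
by elim: s1 t1 => [|x s1 IHs] [|y t1] //= [/IHs->]; rewrite andbA.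
Qed.

Lemma all2_size (T U : Type) (r : T -> U -> bool) s t :
  all2 r s t -> size s = size t.
Proof. by rewrite all2E => /andP[/eqP]. Qed.

Section RuleSteps.
Implicit Types (c : symbol) (x y z p q : word).

Lemma rule_step_cat c x p q y : rule_step (c, x) (p ++ q) y ->
  (exists2 p', rule_step (c, x) p p' & y = p' ++ q) \/
  (exists2 q', rule_step (c, x) q q' & y = p ++ q').
Proof.
move=> [u [v [/= e ->]]]; elim: p u e => [|a p IHp] [|b u] /=.
- by move=> ->; right; exists (x ++ v) => //; exists [::], v.
- move=> ->; right; exists (b :: u ++ x ++ v) => //.
  by exists (b :: u), v.
- move=> [-> <-]; left; exists (x ++ p); last by rewrite catA.
  by exists [::], p.
- move=> [-> e]; case: (IHp _ e) => [[p' [u' [v' [-> /= ->]]] h]|[q' h ->]].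
    left; exists (b :: u' ++ x ++ v'); last by rewrite h.
    by exists (b :: u'), v'.
  by right; exists q'.
Qed.

Lemma rule_step_cons c x d q y : rule_step (c, x) (d :: q) y ->
  (d = c /\ y = x ++ q) \/ (exists2 q', rule_step (c, x) q q' & y = d :: q').
Proof.
move=> [[|b u] [v [/= [-> ->] ->]]]; [by left | right].
by exists (u ++ x ++ v) => //; exists u, v.
Qed.

Lemma rule_step_notin c x p y : c \notin p -> ~ rule_step (c, x) p y.
Proof. by move=> cp [u [v [/= e _]]]; rewrite e mem_cat inE eqxx orbT in cp. Qed.

Lemma rule_step_nil r y : ~ rule_step r [::] y.
Proof. by case=> [[|? ?] [v []]]. Qed.

Lemma rule_step_mid c x p q : rule_step (c, x) (p ++ c :: q) (p ++ x ++ q).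
Proof. by exists p, q. Qed.

Lemma rule_step_count c x y z (P : pred symbol) : rule_step (c, x) y z ->
  count P z + P c = count P y + count P x.
Proof. by move=> [u [v [/= -> ->]]]; rewrite !count_cat /=; lia. Qed.

Lemma rule_step_filter0 c y z (P : pred symbol) : ~~ P c ->
  rule_step (c, [::]) y z -> filter P z = filter P y.
Proof.
by move=> /negbTE Pc [u [v [/= -> ->]]]; rewrite !filter_cat /= Pc.
Qed.

End RuleSteps.

(** * The erasing phase *)

Section Reduction.
Variables S A B D : symbol.
Hypothesis uSABD : uniq [:: S; A; B; D].

Definition pop_rules : seq (symbol * word) := [:: (D, [::]); (B, [:: D])].

(** Two [B]s on one side always permit a pop, a single [B] only once the facing block is exhausted;
    so exactly the pair of exponents 1 and 1 is blocked. Forbidding [DDD] keeps the four popping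
    matrices from acting between [m_mark] and [m_collapse]. *)
Definition m_left2 : matrix :=
  (pop_rules, (Some [:: B; B; D; D], Some [:: D; D; D])).
Definition m_right2 : matrix :=
  (pop_rules, (Some [:: D; D; B; B], Some [:: D; D; D])).
Definition m_left : matrix :=
  (pop_rules, (Some [:: B; D; D; A], Some [:: D; D; D])).
Definition m_right : matrix :=
  (pop_rules, (Some [:: A; D; D; B], Some [:: D; D; D])).
Definition m_mark : matrix :=
  ([:: (A, [:: D]); (A, [:: D])], (Some [:: A; D; D; A], Some [:: B; D])).
Definition m_collapse : matrix :=
  ([:: (D, [::]); (D, [::])], (Some [:: D; D; D; D], None)).
(** Needed for the last facing pair, where marking and collapsing would leave [DD] for ever. It is
    used twice, once for each [D]. At its first use [DA] says that the right block is empty, and the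
    absence of [BD] says so for the left one. *)
Definition m_finish : matrix :=
  ([:: (D, [::]); (A, [::])], (Some [:: D; A], Some [:: B; D])).

Definition cond_matrices : seq matrix :=
  [:: m_left2; m_right2; m_left; m_right; m_mark; m_collapse; m_finish].

(** The generating phase may mix code blocks and letters on the right; only a terminal outcome
    forces all blocks to precede all letters. *)
Definition item := (nat + symbol)%type.

Definition item_word (x : item) : word :=
  match x with inl j => nseq j B ++ [:: A] | inr a => [:: a] end.

(** The head of [s] is the block next to the marker, as it is for [rword], so that facing blocks
    have equal positions in the two lists. *)
Fixpoint lword (s : seq nat) : word :=
  if s is i :: s' then lword s' ++ A :: nseq i B else [::].

Definition rword (r : seq item) : word := flatten (map item_word r).

Definition compat (i j : nat) : bool := (i == 2) || (j == 2).

Definition short (i : nat) : bool := (0 < i) && (i <= 2).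

Definition item_ok (x : item) : bool :=
  match x with inl j => short j | inr a => a \notin [:: S; A; B; D] end.

Definition cstep (x y : word) : Prop :=
  exists2 r, r \in cond_matrices & matrix_step r x y.

Lemma neqs : ((S == A) = false) * ((S == B) = false) * ((S == D) = false) *
  ((A == B) = false) * ((A == D) = false) * ((B == D) = false) *
  ((A == S) = false) * ((B == S) = false) * ((D == S) = false) *
  ((B == A) = false) * ((D == A) = false) * ((D == B) = false).
Proof.
move: uSABD; rewrite /= !inE !negb_or -!andbA.
case/and5P=> h1 h2 h3 h4 /and3P[h5 h6 _].
rewrite ![_ == S]eq_sym ![B == A]eq_sym ![D == _]eq_sym.
by rewrite (negbTE h1) (negbTE h2) (negbTE h3) (negbTE h4) (negbTE h5) (negbTE h6).
Qed.

Lemma mem_lword c s : c \in lword s -> c = A \/ c = B.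
Proof.
elim: s => //= i s IHs; rewrite mem_cat inE mem_nseq.
by case/or3P=> [/IHs|/eqP|/andP[_ /eqP]]; [|left|right].
Qed.

Lemma notin_lword c s : c != A -> c != B -> c \notin lword s.
Proof. by move=> cA cB; apply/negP => /mem_lword[] /eqP; apply/negP. Qed.

Lemma notin_rword c r : all item_ok r -> c \in [:: S; D] -> c \notin rword r.
Proof.
move=> + cSD; elim: r => //= x r IHr /andP[ox /IHr h].
rewrite /rword /= mem_cat negb_or; apply/andP; split=> //.
have cAB : (c == A = false) * (c == B = false).
  by move: cSD; rewrite !inE => /orP[] /eqP ->; rewrite !neqs.
case: x ox => [j _|a] /=.
  by rewrite mem_cat mem_nseq inE !cAB andbF.
rewrite !inE; apply: contra => /eqP <-.
by move: cSD; rewrite !inE => /orP[] ->; rewrite ?orbT.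
Qed.

(** Without [DD] only [m_finish] can act, and it never touches a [B]. The bound 2 is kept because
    one use of [m_finish] leaves at most one [D], so [DD] cannot reappear. *)
Definition dead (w : word) : Prop :=
  [/\ B \in w, ~~ infix [:: D; D] w & count_mem D w <= 2].

Lemma cstep_inv x y : cstep x y ->
  [\/ [/\ ~~ infix [:: D; D; D] x, rules_apply pop_rules x y &
       [|| infix [:: B; B; D; D] x, infix [:: D; D; B; B] x,
           infix [:: B; D; D; A] x | infix [:: A; D; D; B] x]],
      [/\ infix [:: A; D; D; A] x, ~~ infix [:: B; D] x &
          rules_apply (mrules m_mark) x y],
      infix [:: D; D; D; D] x /\ rules_apply (mrules m_collapse) x y |
      [/\ infix [:: D; A] x, ~~ infix [:: B; D] x &
          rules_apply (mrules m_finish) x y]].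
Proof.
case=> r; rewrite !inE.
case/orP=> [/eqP->|]; first by
  move=> [/(_ _ erefl) h /(_ _ erefl) g a]; constructor 1; rewrite h.
case/orP=> [/eqP->|]; first by
  move=> [/(_ _ erefl) h /(_ _ erefl) g a]; constructor 1; rewrite h orbT.
case/orP=> [/eqP->|]; first by
  move=> [/(_ _ erefl) h /(_ _ erefl) g a]; constructor 1; rewrite h !orbT.
case/orP=> [/eqP->|]; first by
  move=> [/(_ _ erefl) h /(_ _ erefl) g a]; constructor 1; rewrite h !orbT.
case/orP=> [/eqP->|]; first by
  move=> [/(_ _ erefl) h /(_ _ erefl) g a]; constructor 2.
case/orP=> /eqP->; first by
  move=> [/(_ _ erefl) h _ a]; constructor 3.
by move=> [/(_ _ erefl) h /(_ _ erefl) g a]; constructor 4.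
Qed.

Lemma infix_pop_DD x :
  [|| infix [:: B; B; D; D] x, infix [:: D; D; B; B] x,
      infix [:: B; D; D; A] x | infix [:: A; D; D; B] x] ->
  infix [:: D; D] x.
Proof.
case/or4P.
- exact: (@catl_infix _ [:: B; B]).
- exact: (@catr_infix _ [:: B; B] [:: D; D]).
- by move/(@catl_infix _ [:: B])/(@catr_infix _ [:: A] [:: D; D]).
- by move/(@catl_infix _ [:: A])/(@catr_infix _ [:: B] [:: D; D]).
Qed.

(** Every permitting word but that of [m_finish] contains [DD]. The [A] erased by [m_finish] may be
    anywhere, so only counts and the subsequence of the other letters are tracked. *)
Lemma cstep_noDD x y : ~~ infix [:: D; D] x -> cstep x y ->
  [/\ D \in x, count_mem D y = (count_mem D x).-1,
      count_mem A y = (count_mem A x).-1, A \in x &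
      {in predC (mem [:: A; D]), forall c, count_mem c y = count_mem c x} /\
      filter (predC (mem [:: A; D])) y = filter (predC (mem [:: A; D])) x].
Proof.
move=> nDD /cstep_inv[[_ _ /infix_pop_DD]|[h _ _]|[h _]|[_ _]].
- by rewrite (negbTE nDD).
- move/(@catl_infix _ [:: A])/(@catr_infix _ [:: A] [:: D; D]): h.
  by rewrite (negbTE nDD).
- by move/(@catr_infix _ [:: D; D] [:: D; D]): h; rewrite (negbTE nDD).
move=> [z [h1 [y' [h2 <-]]]] {y}.
have cD := rule_step_count (pred1 D) h1; have cD' := rule_step_count (pred1 D) h2.
have cA := rule_step_count (pred1 A) h1; have cA' := rule_step_count (pred1 A) h2.
move: cD cD' cA cA'; rewrite /= !eqxx !neqs ?addn0 !addn1 => cD cD' cA cA'.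
split; last split.
- by rewrite -has_pred1 has_count -cD.
- by rewrite -cD cD'.
- by rewrite -cA -cA'.
- by rewrite -has_pred1 has_count -cA -cA'.
- move=> c; rewrite !inE negb_or => /andP[nA nD].
  have := rule_step_count (pred1 c) h1; have := rule_step_count (pred1 c) h2.
  by rewrite /= ![_ == c]eq_sym (negbTE nA) (negbTE nD) !addn0 => -> ->.
rewrite (rule_step_filter0 _ h2) ?(rule_step_filter0 _ h1) //= !inE eqxx ?orbT //.
Qed.

Lemma dead_cstep x y : dead x -> cstep x y -> dead y.
Proof.
move=> [Bx nDD cD] /(cstep_noDD nDD)[_ eD _ _ [eC _]]; split.
- rewrite -has_pred1 has_count eC ?inE ?neqs //.
  by rewrite -has_count has_pred1.
- by apply/negP => /infix_count2; lia.
- by lia.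
Qed.

Lemma infix_DD a b u v : D \notin a -> D \notin u -> D \notin v ->
  infix (a ++ D :: D :: b) (u ++ D :: D :: v) = suffix a u && prefix b v.
Proof.
move=> Da Du Dv; rewrite infix_cut // infix_cut0 // infix_notin // orbF.
by rewrite prefix_cons eqxx (prefix_notin _ Dv) andbF orbF.
Qed.

Lemma infix_DDD u v : D \notin u -> D \notin v ->
  infix [:: D; D; D] (u ++ D :: D :: v) = false.
Proof.
by move=> Du Dv; rewrite (@infix_DD [::] [:: D]) // (prefix_notin _ Dv) andbF.
Qed.

Lemma infix_DDDD u v : D \notin u -> D \notin v ->
  infix [:: D; D; D; D] (u ++ D :: D :: v) = false.
Proof.
move=> Du Dv; apply/negbTE/negP => /(@catr_infix _ [:: D] [:: D; D; D]).
by rewrite infix_DDD.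
Qed.

Lemma infix_BD u v : D \notin u -> D \notin v ->
  infix [:: B; D] (u ++ D :: D :: v) = suffix [:: B] u.
Proof.
move=> Du Dv; rewrite (@infix_cut _ D [:: B] [::]) ?inE ?neqs //.
rewrite (@infix_cut0 _ D [:: B] [::]) ?inE ?neqs //.
by rewrite (@infix_notin _ D [:: B] [::]) //= andbT orbF.
Qed.

Lemma infix_DA u v : D \notin u -> D \notin v ->
  infix [:: D; A] (u ++ D :: D :: v) = prefix [:: A] v.
Proof.
move=> Du Dv; rewrite (@infix_cut _ D [::] [:: A]) // prefix_cons neqs andbF.
rewrite (@infix_cut0 _ D [::] [:: A]) //.
by rewrite (@infix_notin _ D [::] [:: A]) // orbF.
Qed.

Lemma cstep_DD u v y : D \notin u -> D \notin v -> cstep (u ++ D :: D :: v) y ->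
  [\/ rules_apply pop_rules (u ++ D :: D :: v) y /\
      [|| suffix [:: B; B] u, prefix [:: B; B] v,
          suffix [:: B] u && prefix [:: A] v | suffix [:: A] u && prefix [:: B] v],
      [/\ suffix [:: A] u, prefix [:: A] v &
          rules_apply (mrules m_mark) (u ++ D :: D :: v) y] |
      [/\ prefix [:: A] v, ~~ suffix [:: B] u &
          rules_apply (mrules m_finish) (u ++ D :: D :: v) y]].
Proof.
have DAB : (D \notin [:: B; B]) * (D \notin [:: B]) * (D \notin [:: A]).
  by rewrite !inE !neqs.
move=> Du Dv /cstep_inv[[_ h]|[]|[]|[]].
- rewrite (@infix_DD [:: B; B] [::]) ?DAB // (@infix_DD [::] [:: B; B]) //.
  rewrite (@infix_DD [:: B] [:: A]) ?DAB // (@infix_DD [:: A] [:: B]) ?DAB //.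
  by rewrite prefix0s suffix0s andbT => g; constructor 1.
- rewrite (@infix_DD [:: A] [:: A]) ?DAB // => /andP[*].
  by constructor 2.
- by rewrite infix_DDDD.
- by rewrite infix_DA // infix_BD // => *; constructor 3.
Qed.

Lemma pop_outcome u v y : D \notin u -> D \notin v ->
  suffix [:: B] u || prefix [:: B] v ->
  rules_apply pop_rules (u ++ D :: D :: v) y ->
  [\/ exists2 x, u = x ++ [:: B] & y = x ++ D :: D :: v,
      exists2 x, v = B :: x & y = u ++ D :: D :: x |
      dead y].
Proof.
move=> Du Dv hB [z [h1 [y' [h2 <-]]]] {y}.
(* Both choices of the erased [D] give the same word; only the choice of [B] matters. *)
have {h1} ez : z = u ++ D :: v.
  case/rule_step_cat: h1 => [[p' /(rule_step_notin Du)] //|[q' h ->]].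
  case/rule_step_cons: h => [[_ ->] //|[q'' + ->]].
  case/rule_step_cons=> [[_ -> //]|[? /(rule_step_notin Dv)] //].
have nDD (p q r : word) : D \notin p -> D \notin q -> D \notin r -> q != [::] ->
    B \in p ++ q ++ r -> dead (p ++ D :: q ++ D :: r).
  move=> Dp Dq Dr q0 Bw; split.
  - by move: Bw; rewrite !(mem_cat, inE) neqs.
  - rewrite (@infix_cut _ D [::] [:: D]) // suffix0s /=.
    rewrite (@infix_cut _ D [::] [:: D]) // suffix0s (@infix_notin _ D [::] [:: D]) //.
    rewrite (prefix_notin _ Dr) /= orbF.
    case: q q0 Dq {Bw} => //= c q _.
    by rewrite inE negb_or => /andP[/negbTE-> _].
  - rewrite count_cat /= count_cat /= !eqxx.
    by rewrite (count_memPn Dp) (count_memPn Dq) (count_memPn Dr).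
move: h2; rewrite ez; case/rule_step_cat=> [[p' [x [t [/= eu ->]]] ->]|[q' h ->]].
- case: t eu => [|c t] eu; first by constructor 1; exists x; rewrite // -catA.
  have := Du; rewrite eu mem_cat !in_cons !negb_or => /and4P[Dx _ Dc Dt].
  (* The rewritten [B] lies further left: [c :: t] separates the two [D]s, and the [B] next to the
     marker survives in [c :: t] or at the head of [v]. *)
  constructor 3; rewrite -catA /= -cat_cons; apply: nDD; rewrite ?inE ?negb_or ?Dc //.
  case/orP: hB => [/suffixP[s]|/prefixP[s ->]]; last by rewrite !mem_cat mem_head !orbT.
  rewrite eu => /(congr1 (last D)); rewrite !last_cat /= => e.
  have Bt : B \in c :: t by rewrite -e mem_last.
  by rewrite mem_cat -cat_cons mem_cat Bt !orbT.
- case/rule_step_cons: h => [[/eqP]|[q'' [x [t [/= ev ->]]] ->]]; first by rewrite neqs.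
  case: x ev => [|c x] ev; first by constructor 2; exists t.
  have := Dv; rewrite ev in_cons mem_cat in_cons !negb_or => /and4P[Dc Dx _ Dt].
  constructor 3; apply: nDD; rewrite ?inE ?negb_or ?Dc //.
  case/orP: hB => [/suffix1s Bu|/prefixP[s]]; first by rewrite mem_cat Bu.
  by rewrite ev => -[-> _]; rewrite !(mem_cat, inE) eqxx !orbT.
Qed.

(** * Wrong choices of the two letters to be marked *)

Definition stuck (w : word) : Prop := D \in w /\ forall y, ~ cstep w y.

(** [DDD] blocks every pop, the lack of [DDDD] blocks the collapse, and [m_mark] and [m_finish] each
    fail by the permitting or by the forbidden word. *)
Lemma stuck_DDD w : infix [:: D; D; D] w -> ~~ infix [:: D; D; D; D] w ->
  ~~ infix [:: A; D; D; A] w || infix [:: B; D] w ->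
  ~~ infix [:: D; A] w || infix [:: B; D] w -> stuck w.
Proof.
move=> h3 h4 hm hf; split.
  by case/infixP: h3 => [x [y ->]]; rewrite mem_cat mem_head orbT.
move=> y /cstep_inv[[]|[g h]|[]|[g h]]; first by rewrite h3.
- by rewrite g (negbTE h) in hm.
- by rewrite (negbTE h4).
- by rewrite g (negbTE h) in hf.
Qed.

(** Meant for the case that no letter next to the marker was marked. Each popping matrix needs [BDD]
    or [DDB], and [BD] blocks [m_mark] and [m_finish]. *)
Lemma stuck_ADDA w : ~~ infix [:: B; D; D] w -> ~~ infix [:: D; D; B] w ->
  ~~ infix [:: D; D; D; D] w -> infix [:: B; D] w -> stuck w.
Proof.
move=> h1 h2 h4 hB; split.
  by case/infixP: hB => [x [y ->]]; rewrite !(mem_cat, in_cons) eqxx !orbT.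
move=> y /cstep_inv[[_ _ /or4P[]]|[_]|[]|[_]]; rewrite ?hB ?(negbTE h4) //.
- by move/(@catl_infix _ [:: B] [:: B; D; D]); apply/negP.
- by move/(@catr_infix _ [:: B] [:: D; D; B]); apply/negP.
- by move/(@catr_infix _ [:: A] [:: B; D; D]); apply/negP.
- by move/(@catl_infix _ [:: A] [:: D; D; B]); apply/negP.
Qed.

Lemma cutD b p w : D \notin p ->
  infix (D :: b) (p ++ D :: w) = prefix b w || infix (D :: b) w.
Proof. by move=> Dp; rewrite (@infix_cut _ D [::]) // suffix0s. Qed.

Lemma cutD0 b w : infix (D :: b) (D :: w) = prefix b w || infix (D :: b) w.
Proof. by rewrite (@infix_cut0 _ D [::]). Qed.

Lemma cutcD c b p w : D != c -> D \notin p ->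
  infix (c :: D :: b) (p ++ D :: w) =
  (suffix [:: c] p && prefix b w) || infix (c :: D :: b) w.
Proof. by move=> Dc Dp; rewrite (@infix_cut _ D [:: c]) // inE. Qed.

Lemma cutcD0 c b w : D != c ->
  infix (c :: D :: b) (D :: w) = infix (c :: D :: b) w.
Proof. by move=> Dc; rewrite (@infix_cut0 _ D [:: c]) // inE. Qed.

Lemma suffix1_rcons (c d : symbol) (p : word) : suffix [:: c] (p ++ [:: d]) = (c == d).
Proof.
by rewrite cats1 (@suffix_rcons _ [::]) suffix0s andbT.
Qed.

Definition infixE := (cutD, cutcD, cutD0, cutcD0,
  (fun b => @infix_notin _ D [::] b), (fun c b => @infix_notin _ D [:: c] b)).

(** A stretch following or preceding a misplaced [D]. The prefix fields allow any continuation [w],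
    so that they rewrite inside longer words. *)
Record gap (y : word) : Prop := Gap {
  gap_D : D \notin y;
  gap_headA : forall b w, prefix (A :: b) (y ++ w) = false;
  gap_headD : forall b w, prefix (D :: b) (y ++ w) = false;
  gap_B : suffix [:: B] y;
  gap_A : suffix [:: A] y = false }.

Lemma gapI c (x y : word) : D \notin x -> x = c :: y -> c != A -> suffix [:: B] x -> gap x.
Proof.
move=> Dx e cA Bx; have cD : D != c.
  by move: Dx; rewrite e in_cons negb_or => /andP[].
split=> // [b w|b w|].
- by rewrite e cat_cons prefix_cons eq_sym (negbTE cA).
- by rewrite e cat_cons prefix_cons (negbTE cD).
- by case/suffixP: Bx => z ->; rewrite suffix1_rcons neqs.
Qed.

Lemma notinD_rconsA (x : word) : D \notin x -> D \notin x ++ [:: A].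
Proof. by rewrite mem_cat inE neqs orbF. Qed.

Lemma notinD_consA (x : word) : D \notin x -> D \notin A :: x.
Proof. by rewrite inE neqs. Qed.

(** From here on, one lemma for each wrong choice of two [A]s. Here both are on the left, one of
    them next to the marker, and the [B] ending [y] yields [BD]. *)
Lemma stuck_left_center x y z : D \notin x -> D \notin z -> gap y ->
  stuck (x ++ D :: y ++ D :: D :: D :: A :: z).
Proof.
move=> Dx Dz [Dy yA yD yB yA'].
have DA : D != A by rewrite neqs.
have DB : D != B by rewrite neqs.
have nA := notinD_consA; have nrA := notinD_rconsA.
by apply: stuck_DDD; rewrite ?infixE ?nA ?nrA ?yD ?yB ?yA ?yA' ?suffix1_rcons
  //= ?eqxx ?neqs ?prefix0s ?orbT.
Qed.

Lemma stuck_center_right u x y : D \notin u -> D \notin y -> gap x ->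
  stuck (u ++ D :: D :: D :: (A :: x) ++ D :: y).
Proof.
move=> Du Dy [Dx xA xD xB xA'].
have DA : D != A by rewrite neqs.
have DB : D != B by rewrite neqs.
have nA := notinD_consA; have nrA := notinD_rconsA.
have sB : suffix [:: B] (A :: x) by rewrite suffix_consl xB orbT.
by apply: stuck_DDD; rewrite ?infixE ?nA ?nrA ?xD ?sB ?xB ?xA ?xA' ?suffix1_rcons
  //= ?eqxx ?neqs ?prefix0s ?orbT ?xD ?(prefix_notin _ Dy) ?andbF ?orbF ?andbT ?orbT.
Qed.

(** If [x] is empty, there need not be any [BD]. What blocks [m_mark] and [m_finish] is that no [D]
    is followed by [A], neither [y] nor [z] starting with [A]. *)
Lemma stuck_right_center x y z : D \notin x -> D \notin z -> prefix [:: A] z = false ->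
  gap y -> stuck (x ++ D :: (y ++ [:: A]) ++ D :: D :: D :: z).
Proof.
move=> Dx Dz Az [Dy yA yD yB yA'].
have DA : D != A by rewrite neqs.
have DB : D != B by rewrite neqs.
have nA := notinD_consA; have nrA := notinD_rconsA.
have yA2 b w : prefix (A :: b) ((y ++ [:: A]) ++ w) = false by rewrite -catA.
have yD2 b w : prefix (D :: b) ((y ++ [:: A]) ++ w) = false by rewrite -catA.
by apply: stuck_DDD; rewrite ?infixE ?nA ?nrA ?yD2 ?yB ?yA2 ?yA' ?suffix1_rcons
  //= ?eqxx ?neqs ?prefix0s ?orbT ?(prefix_notin _ Dz) ?Az ?andbF //.
Qed.

Lemma stuck_right_right u x y : D \notin u -> D \notin y -> gap x ->
  stuck ((u ++ [:: A]) ++ D :: D :: D :: x ++ D :: y).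
Proof.
move=> Du Dy [Dx xA xD xB xA'].
have DA : D != A by rewrite neqs.
have DB : D != B by rewrite neqs.
have nA := notinD_consA; have nrA := notinD_rconsA.
by apply: stuck_DDD; rewrite ?infixE ?nA ?nrA ?xD ?xB ?xA ?xA' ?suffix1_rcons
  //= ?eqxx ?neqs ?prefix0s ?orbT ?xD ?xA ?(prefix_notin _ Dy) ?andbF ?orbF ?andbT ?orbT.
Qed.

Lemma stuck_left_left x y y' z : D \notin x -> D \notin z -> gap y -> gap y' ->
  stuck (x ++ D :: y ++ D :: (y' ++ [:: A]) ++ D :: D :: A :: z).
Proof.
move=> Dx Dz [Dy yA yD yB yA'] [Dy' y'A y'D y'B y'A'].
have DA : D != A by rewrite neqs.
have DB : D != B by rewrite neqs.
have nA := notinD_consA; have nrA := notinD_rconsA.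
have yD2 b w : prefix (D :: b) ((y' ++ [:: A]) ++ w) = false by rewrite -catA.
by apply: stuck_ADDA; rewrite ?infixE ?nA ?nrA ?yD ?yD2 ?yB ?suffix1_rcons
  //= ?eqxx ?neqs ?prefix0s ?andbF ?orbF ?orbT ?andbF ?orbF.
Qed.

Lemma stuck_left_right x y x' y' : D \notin x -> D \notin y' -> gap y -> gap x' ->
  stuck (x ++ D :: (y ++ [:: A]) ++ D :: D :: (A :: x') ++ D :: y').
Proof.
move=> Dx Dz [Dy yA yD yB yA'] [Dy' y'A y'D y'B y'A'].
have DA : D != A by rewrite neqs.
have DB : D != B by rewrite neqs.
have nA := notinD_consA; have nrA := notinD_rconsA.
have yD2 b w : prefix (D :: b) ((y ++ [:: A]) ++ w) = false by rewrite -catA.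
have sB : suffix [:: B] (A :: x') by rewrite suffix_consl y'B orbT.
by apply: stuck_ADDA; rewrite ?infixE ?nA ?nrA ?yD ?yD2 ?yB ?sB ?suffix1_rcons
  //= ?eqxx ?neqs ?prefix0s ?andbF ?orbF ?orbT ?yD2 ?y'D ?(prefix_notin _ Dz) ?andbF ?orbF ?andbT ?orbT.
Qed.

Lemma stuck_right_right2 u x x' y : D \notin u -> D \notin y -> gap x -> gap x' ->
  stuck ((u ++ [:: A]) ++ D :: D :: (A :: x) ++ D :: x' ++ D :: y).
Proof.
move=> Dx Dz [Dy yA yD yB yA'] [Dy' y'A y'D y'B y'A'].
have DA : D != A by rewrite neqs.
have DB : D != B by rewrite neqs.
have nA := notinD_consA; have nrA := notinD_rconsA.
have sB : suffix [:: B] (A :: x) by rewrite suffix_consl yB orbT.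
by apply: stuck_ADDA; rewrite ?infixE ?nA ?nrA ?yD ?y'D ?yB ?sB ?suffix1_rcons
  //= ?eqxx ?neqs ?prefix0s ?andbF ?orbF ?orbT ?yD ?y'D ?(prefix_notin _ Dz) ?andbF ?orbF ?andbT ?orbT.
Qed.

Lemma suffix_nseq p i : 0 < i -> suffix [:: B] (p ++ nseq i B).
Proof.
by case: i => // i _; rewrite -addn1 nseqD catA suffix_suffix.
Qed.

Lemma suffix_A_nseq p i : 0 < i -> suffix [:: B] (p ++ A :: nseq i B).
Proof. by rewrite -cat_rcons; exact: suffix_nseq. Qed.

Lemma lword_split s x y : all short s -> lword s = x ++ A :: y ->
  [/\ exists y', y = B :: y', suffix [:: B] y & x = [::] \/ suffix [:: B] x].
Proof.
elim: s x y => [|i s IHs] x y /=; first by case: x.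
case/andP=> /andP[i0 i2] os e0; case: (cat_eq_mid e0) => [[t e ->]|[t ex e]] {e0}; last rewrite {}ex.
  case: (IHs _ _ os e) => [[y' ey] h1 h2]; rewrite {}ey in h1 *.
  split=> //; first by exists (y' ++ A :: nseq i B).
  exact: suffix_A_nseq.
case: t e => [[e]|a t [_ e]].
  rewrite cats0 -e; split.
  - by case: i i0 {i2 e} => // i _; exists (nseq i B).
  - exact: (@suffix_nseq [::]).
  case: s os {IHs} => [|j s] /=; first by left.
  by case/andP=> /andP[j0 _] _; right; exact: suffix_A_nseq.
have : A \in nseq i B by rewrite e mem_cat mem_head orbT.
by rewrite mem_nseq neqs andbF.
Qed.

Lemma rword_head r : all item_ok r -> prefix [:: A] (rword r) = false.
Proof.
case: r => [|[j|a] r] //=; first by case: j => //= j _; rewrite neqs.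
rewrite !inE !negb_or eq_sym => /andP[/and4P[_ /negbTE aA _ _] _].
by rewrite eq_sym aA.
Qed.

Lemma rword_split r x y : all item_ok r -> rword r = x ++ A :: y ->
  suffix [:: B] x /\ prefix [:: A] y = false.
Proof.
elim: r x => [|c r IHr] x /=; first by case: x.
case/andP=> oc or e0; case: (cat_eq_mid e0) => [[t ec ->]|[t ex e]] {e0}; last first.
  rewrite {}ex.
  case: (IHr _ or e) => h1 h2; split=> //; case/suffixP: h1 => z ->.
  by rewrite catA suffix_suffix.
case: c oc ec => [j|a] /=; last first.
  case: x => [|b x] /=; last by case: x.
  by rewrite !inE !negb_or => /and4P[_ aA _ _] [e]; rewrite e eqxx in aA.
case/andP=> j0 _ e0; case: (cat_eq_mid e0) => [[t' e _]|[[|b t'] ->]] {e0}.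
- have : A \in nseq j B by rewrite e mem_cat mem_head orbT.
  by rewrite mem_nseq neqs andbF.
- rewrite cats0 => -[<-]; split; last exact: rword_head.
  exact: (@suffix_nseq [::]).
- by case=> _; case: t'.
Qed.

Lemma suffix1_cut (c d : symbol) (p q : word) :
  c != d -> suffix [:: c] (p ++ d :: q) -> suffix [:: c] q.
Proof.
move=> cd; case: (lastP q) => [|q' b]; first by rewrite suffix1_rcons (negbTE cd).
rewrite -cats1 -cat_cons catA suffix1_rcons => /eqP->.
exact: suffix_suffix.
Qed.

Lemma lword_gap s x y : all short s -> lword s = x ++ A :: y ->
  D \notin x /\ gap y.
Proof.
move=> os e; case: (lword_split os e) => [[y' ey] By _].
have := @notin_lword D s; rewrite e !neqs mem_cat in_cons !negb_or.
move=> /(_ isT isT)/and3P[Dx _ Dy]; split=> //.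
by apply: (gapI Dy ey _ By); rewrite neqs.
Qed.

Lemma lword_gap2 s x y y' : all short s -> lword s = x ++ A :: y ++ A :: y' ->
  [/\ D \notin x, gap y & gap y'].
Proof.
move=> os e; have [Dx [+ _ _ _ _]] := lword_gap os e.
rewrite mem_cat negb_or => /andP[Dy _].
have e' : lword s = (x ++ A :: y) ++ A :: y' by rewrite -catA.
have [_ gy'] := lword_gap os e'; split=> //.
case: (lword_split os e) => [[y0 ey] _ _].
case: (lword_split os e') => _ _ [|/suffix1_cut]; first by case: (x).
rewrite neqs => /(_ isT) By.
case: y Dy By ey {e e'} => [_|b y Dy By [eb _]]; first by move/suffix1s.
by apply: (gapI Dy erefl _ By); rewrite eb neqs.
Qed.

Lemma rword_gap r x y : all item_ok r -> rword r = x ++ A :: y ->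
  D \notin y /\ gap x.
Proof.
move=> or e; have [Bx _] := rword_split or e.
have := notin_rword or (_ : D \in [:: S; D]); rewrite !inE eqxx orbT e.
rewrite mem_cat in_cons !negb_or => /(_ isT)/and3P[Dx _ Dy]; split=> //.
have := rword_head or; rewrite e.
case: x Dx Bx {e} => [_ /suffix1s //|b x Dx Bx].
by rewrite /= prefix0s andbT eq_sym => /negbT bA; apply: (gapI Dx erefl bA Bx).
Qed.

Lemma rword_gap2 r x x' y : all item_ok r -> rword r = x ++ A :: x' ++ A :: y ->
  [/\ D \notin y, gap x & gap x'].
Proof.
move=> or e; have [+ gx] := rword_gap or e.
rewrite mem_cat in_cons !negb_or => /and3P[Dx' _ Dy].
have e' : rword r = (x ++ A :: x') ++ A :: y by rewrite -catA.
split=> //; have [/suffix1_cut + _] := rword_split or e'.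
rewrite neqs => /(_ isT) Bx'; have [_] := rword_split or e.
case: x' Dx' Bx' {e e'} => [_ /suffix1s //|b x' Dx' Bx'].
by rewrite /= prefix0s andbT eq_sym => /negbT bA; apply: (gapI Dx' erefl bA Bx').
Qed.

Lemma mark_left s p : all short s -> rule_step (A, [:: D]) (lword s ++ [:: A]) p ->
  p = lword s ++ [:: D] \/
  exists x y, [/\ lword s = x ++ A :: y & p = x ++ D :: y ++ [:: A]].
Proof.
move=> os /rule_step_cat[[p' [x [y [/= e ->]]] ->]|[q + ->]].
  by right; exists x, y; rewrite -catA.
case/rule_step_cons=> [[_ ->]|[q' /rule_step_nil] //].
by left.
Qed.

Lemma mark_left2 s p p' : all short s ->
  rule_step (A, [:: D]) (lword s ++ [:: A]) p -> rule_step (A, [:: D]) p p' ->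
  (exists x y, [/\ D \notin x, gap y & p' = x ++ D :: y ++ [:: D]]) \/
  (exists x y y', [/\ D \notin x, gap y, gap y' &
     p' = x ++ D :: y ++ D :: y' ++ [:: A]]).
Proof.
move=> os /(mark_left os)[->|[x [y [e ->]]]].
  case/rule_step_cat=> [[q [x [y [/= e ->]]] ->]|[q + _]].
    by left; exists x, y; have [] := lword_gap os e; rewrite -catA.
  case/rule_step_cons=> [[/eqP]|[q' /rule_step_nil] //].
  by rewrite neqs.
have [Dx gy] := lword_gap os e.
case/rule_step_cat=> [[q [x1 [x2 [/= ex ->]]] ->]|[q + ->]].
  right; rewrite ex -catA cat_cons in e; have [Dx1 g2 _] := lword_gap2 os e.
  by exists x1, x2, y; rewrite -catA.
case/rule_step_cons=> [[/eqP]|[q' + ->]]; first by rewrite neqs.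
case/rule_step_cat=> [[q'' [y1 [y2 [/= ey ->]]] ->]|[q'' + ->]].
  right; rewrite ey in e; have [_ g1 g2] := lword_gap2 os e.
  by exists x, y1, y2; rewrite -catA.
case/rule_step_cons=> [[_ ->]|[q3 /rule_step_nil] //].
by left; exists x, y.
Qed.

Lemma mark_right r q : rule_step (A, [:: D]) (A :: rword r) q ->
  q = D :: rword r \/
  exists x y, [/\ rword r = x ++ A :: y & q = A :: x ++ D :: y].
Proof.
case/rule_step_cons=> [[_ ->]|[q' [x [y [/= e ->]]] ->]]; first by left.
by right; exists x, y.
Qed.

Lemma mark_right2 r q q' : all item_ok r ->
  rule_step (A, [:: D]) (A :: rword r) q -> rule_step (A, [:: D]) q q' ->
  (exists x y, [/\ D \notin y, gap x & q' = D :: x ++ D :: y]) \/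
  (exists x x' y, [/\ D \notin y, gap x, gap x' &
     q' = A :: x ++ D :: x' ++ D :: y]).
Proof.
move=> or /mark_right[->|[x [y [e ->]]]].
  case/rule_step_cons=> [[/eqP]|[q0 [x [y [/= e ->]]] ->]]; first by rewrite neqs.
  by left; exists x, y; have [] := rword_gap or e.
have [Dy gx] := rword_gap or e.
case/rule_step_cons=> [[_ ->]|[q0 + ->]]; first by left; exists x, y.
case/rule_step_cat=> [[q1 [x1 [x2 [/= ex ->]]] ->]|[q1 + ->]].
  right; rewrite ex -catA cat_cons in e; have [_ g1 g2] := rword_gap2 or e.
  by exists x1, x2, y; rewrite -catA.
case/rule_step_cons=> [[/eqP]|[q2 [y1 [y2 [/= ey ->]]] ->]]; first by rewrite neqs.
right; rewrite ey in e; have [Dy2 _ g1] := rword_gap2 or e.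
by exists x, y1, y2.
Qed.

Lemma rule_step_A_DD p q z : rule_step (A, [:: D]) (p ++ D :: D :: q) z ->
  (exists2 p', rule_step (A, [:: D]) p p' & z = p' ++ D :: D :: q) \/
  (exists2 q', rule_step (A, [:: D]) q q' & z = p ++ D :: D :: q').
Proof.
case/rule_step_cat=> [[p' h ->]|[z' + ->]]; first by left; exists p'.
case/rule_step_cons=> [[/eqP]|[z1 + ->]]; first by rewrite neqs.
case/rule_step_cons=> [[/eqP]|[q' + ->]]; first by rewrite neqs.
by right; exists q'.
Qed.

Lemma mark_outcome s r y : all short s -> all item_ok r ->
  rules_apply (mrules m_mark) ((lword s ++ [:: A]) ++ D :: D :: A :: rword r) y ->
  y = lword s ++ D :: D :: D :: D :: rword r \/ stuck y.
Proof.
move=> os or [z [h1 [y' [h2 <-]]]] {y}.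
have Du : D \notin lword s by rewrite notin_lword ?neqs.
have Dv : D \notin rword r by rewrite notin_rword // !inE eqxx orbT.
(* One mark on each side; stated apart because the two marks may be made in either order. *)
have LR p q : rule_step (A, [:: D]) (lword s ++ [:: A]) p ->
    rule_step (A, [:: D]) (A :: rword r) q ->
    p ++ D :: D :: q = lword s ++ D :: D :: D :: D :: rword r \/
    stuck (p ++ D :: D :: q).
  move=> /(mark_left os)[->|[x [x' [ex ->]]]] /mark_right[->|[t [t' [et ->]]]].
  - by left; rewrite -catA.
  - have [Dt' gt] := rword_gap or et; right.
    by rewrite -catA; exact: stuck_center_right.
  - have [Dx gx] := lword_gap os ex; right.
    rewrite -catA cat_cons; apply: stuck_right_center => //; exact: rword_head.
  - have [Dx gx] := lword_gap os ex; have [Dt' gt] := rword_gap or et; right.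
    by rewrite -catA cat_cons; exact: stuck_left_right.
case/rule_step_A_DD: h1 h2 => [[p h1 ->]|[q h1 ->]] /rule_step_A_DD[[p' h2 ->]|[q' h2 ->]].
- right; case: (mark_left2 os h1 h2) => [[x [t [Dx gt ->]]]|[x [t [t' [Dx gt gt' ->]]]]].
    by rewrite -catA cat_cons -catA; exact: stuck_left_center.
  by rewrite -catA cat_cons -catA cat_cons; exact: stuck_left_left.
- exact: LR.
- exact: LR.
- right; case: (mark_right2 or h1 h2) => [[x [t [Dx gt ->]]]|[x [t [t' [Dx gt gt' ->]]]]].
    exact: stuck_right_right.
  exact: stuck_right_right2.
Qed.

(** The letters of a run are all alike, so the position of the erased one does not show. *)
Lemma rule_step_erase_run n u v z : D \notin u -> D \notin v ->
  rule_step (D, [::]) (u ++ nseq n.+1 D ++ v) z -> z = u ++ nseq n D ++ v.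
Proof.
move=> Du Dv /rule_step_cat[[p /(rule_step_notin Du)] //|[q h ->]].
congr (u ++ _); elim: n q h => [|n IHn] q.
  by case/rule_step_cons=> [[_ ->] //|[q' /(rule_step_notin Dv)]].
case/rule_step_cons=> [[_ ->] //|[q' /IHn -> ->] //].
Qed.

Section Runs.
Variables (p : word) (i : nat).

Lemma suffixB_run : suffix [:: B] (p ++ A :: nseq i B) = (0 < i).
Proof.
by case: i => [|k]; rewrite ?suffix1_rcons ?neqs // suffix_A_nseq.
Qed.

Lemma suffixA_run : suffix [:: A] (p ++ A :: nseq i B) = (i == 0).
Proof.
case: i => [|k]; first by rewrite suffix1_rcons eqxx.
by rewrite -addn1 nseqD -cat_cons catA suffix1_rcons neqs addn1.
Qed.

Lemma suffixBB_run : suffix [:: B; B] (p ++ A :: nseq i B) -> 1 < i.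
Proof.
case: i => [|[|k]] //.
  by move/(@catl_suffix _ [:: B]); rewrite suffix1_rcons neqs.
rewrite /= -[p ++ _]cat_rcons cats1 -[[:: B; B]]/(rcons [:: B] B).
by rewrite suffix_rcons => /andP[_]; rewrite -cats1 suffix1_rcons neqs.
Qed.

Lemma prefixB_run : prefix [:: B] (nseq i B ++ A :: p) = (0 < i).
Proof. by case: i => [|k] /=; rewrite ?neqs ?eqxx ?prefix0s. Qed.

Lemma prefixA_run : prefix [:: A] (nseq i B ++ A :: p) = (i == 0).
Proof. by case: i => [|k] /=; rewrite ?neqs ?eqxx ?prefix0s. Qed.

Lemma prefixBB_run : prefix [:: B; B] (nseq i B ++ A :: p) -> 1 < i.
Proof. by case: i => [|[|k]] /=; rewrite ?neqs ?andbF. Qed.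

End Runs.

(** * The invariant of the erasing phase *)

Section Reachable.
Variables (ls : seq nat) (ri : seq item).
Hypotheses (ls_ok : all short ls) (ri_ok : all item_ok ri).

Definition consumed (p s q : seq nat) (r : seq item) : Prop :=
  [/\ ls = p ++ s, ri = map inl q ++ r & all2 compat p q].

(** In [ReachPair] the facing blocks [i0] and [j0] have shrunk to [i] and [j], which can have begun
    only if they are compatible. [ReachNoLeft], [ReachNoRight], [ReachDead] and [ReachStuck] keep a
    nonterminal for ever. In [ReachFinish], [k] counts the remaining [D]s; as [m_finish] may have
    erased the wrong [A]s, the word is known only up to the positions of [A] and [D]. *)
Inductive reach : word -> Prop :=
| ReachPair p i0 i s q j0 j r of consumed p (i0 :: s) q (inl j0 :: r)
    & i <= i0 & j <= j0 & (i == i0) && (j == j0) || compat i0 j0 :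
    reach ((lword s ++ A :: nseq i B) ++ D :: D :: nseq j B ++ A :: rword r)
| ReachNoLeft v of D \notin v & ~~ prefix [:: A] v : reach ([::] ++ D :: D :: v)
| ReachNoRight u v of D \notin u & D \notin v &
    ~~ prefix [:: A] v & ~~ prefix [:: B] v : reach (u ++ D :: D :: v)
| ReachDead w of dead w : reach w
| ReachMark p s q r of consumed p s q r :
    reach (lword s ++ D :: D :: D :: D :: rword r)
| ReachStuck w of stuck w : reach w
| ReachFinish k p i s q j r w of consumed (rcons p i) s (rcons q j) r
    & k <= 1 & count_mem D w = k
    & count_mem A w = count_mem A (lword s ++ rword r) + k
    & filter (predC (mem [:: A; D])) w =
      filter (predC (mem [:: A; D])) (lword s ++ rword r) : reach w.

Lemma consumed_ok p s q r : consumed p s q r -> all short s /\ all item_ok r.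
Proof.
by case=> e1 e2 _; move: ls_ok ri_ok; rewrite e1 e2 !all_cat => /andP[_ ->] /andP[_ ->].
Qed.

Lemma consumed_rcons p i s q j r : consumed p (i :: s) q (inl j :: r) ->
  compat i j -> consumed (rcons p i) s (rcons q j) r.
Proof.
case=> e1 e2 h c; split; rewrite ?cat_rcons ?map_rcons ?cat_rcons //.
by rewrite -!cats1 all2_cat ?(all2_size h) // h /= c.
Qed.

(** A side that has run out of blocks is a losing shape at once; otherwise a fresh pair of blocks
    faces the marker. *)
Lemma reach_two p s q r : consumed p s q r -> reach (lword s ++ D :: D :: rword r).
Proof.
move=> c; have [os or] := consumed_ok c.
have Du : D \notin lword s by rewrite notin_lword ?neqs.
have Dv : D \notin rword r by rewrite notin_rword // !inE eqxx orbT.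
have := rword_head or.
case: s c os Du => [|i s] c os Du hr.
  by apply: ReachNoLeft; rewrite ?hr.
case: r c or Dv hr => [|[j|a] r] c or Dv hr.
- exact: ReachNoRight.
- have -> : rword (inl j :: r) = nseq j B ++ A :: rword r by rewrite /rword /= -catA.
  by apply: (ReachPair c); rewrite ?eqxx.
- apply: ReachNoRight; rewrite ?hr //.
  case/andP: or => /=; rewrite !inE !negb_or prefix0s andbT [B == _]eq_sym.
  by case/and4P.
Qed.

Lemma reach_cstep x y : reach x -> cstep x y -> reach y.
Proof.
case=> {x}.
- move=> p i0 i s q j0 j r c hi hj hij.
  have [/andP[oi os] /andP[oj or]] := consumed_ok c.
  have Du : D \notin lword s ++ A :: nseq i B.
    by rewrite mem_cat in_cons mem_nseq !negb_or notin_lword ?neqs ?andbF.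
  have Dv : D \notin nseq j B ++ A :: rword r.
    by rewrite mem_cat in_cons mem_nseq !negb_or notin_rword ?inE ?eqxx ?orbT ?neqs ?andbF.
  case/andP: oi => i1 i2; case/andP: oj => /= j1 j2.
  case/(cstep_DD Du Dv)=> [[ha]|[]|[]].
  (* On an untouched pair both blocks are nonempty, so neither [A] touches the marker; the pop was
     then permitted by [BB] on one side, that is, by an exponent 2. *)
  + move=> hP; have hc : compat i0 j0.
      case/orP: hij => // /andP[/eqP ei /eqP ej]; rewrite /compat.
      case/or4P: hP => [/suffixBB_run|/prefixBB_run|/andP[_]|/andP[]].
      - by lia.
      - by lia.
      - by rewrite prefixA_run; lia.
      - by rewrite suffixA_run; lia.
    have hB : suffix [:: B] (lword s ++ A :: nseq i B) ||
              prefix [:: B] (nseq j B ++ A :: rword r).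
      rewrite suffixB_run prefixB_run.
      case/or4P: hP => [/suffixBB_run|/prefixBB_run|/andP[]|/andP[_]].
      - by lia.
      - by lia.
      - by rewrite suffixB_run => ->.
      - by rewrite prefixB_run => ->; rewrite orbT.
    case: (pop_outcome Du Dv hB ha) => [[x e ->]|[x e ->]|]; last exact: ReachDead.
    * case: i {hij Du hP hB ha} hi e => [|i] hi.
        by rewrite !cats1 => /rcons_inj[_ /eqP]; rewrite neqs.
      rewrite -addn1 nseqD -cat_cons catA !cats1 => /rcons_inj[<-].
      by apply: (ReachPair c); rewrite ?hc ?orbT //; lia.
    * case: j {hij Dv hP hB ha} hj e => [|j] hj /=; first by case=> /eqP; rewrite neqs.
      by case=> <-; apply: (ReachPair c); rewrite ?hc ?orbT //; lia.
  + rewrite suffixA_run prefixA_run => /eqP ei /eqP ej.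
    (* Both blocks are empty by now, so the pair is not untouched. *)
    have hc : compat i0 j0 by case/orP: hij => //; lia.
    rewrite ei ej; case/(mark_outcome os or)=> [->|]; last exact: ReachStuck.
    exact: ReachMark (consumed_rcons c hc).
  + rewrite prefixA_run suffixB_run => /eqP ej ei.
    have {}ei : i = 0 by lia.
    have hc : compat i0 j0 by case/orP: hij => //; lia.
    rewrite ei ej => -[z [h1 [y' [h2 <-]]]] {y}.
    have nA : ~~ predC (mem [:: A; D]) A by rewrite /= !inE eqxx.
    have nD : ~~ predC (mem [:: A; D]) D by rewrite /= !inE eqxx orbT.
    (* One [D] remains, and one of the two [A]s of the finished pair is in surplus. *)
    apply: (@ReachFinish 1 _ _ _ _ _ _ _ (consumed_rcons c hc)) => //.
    * have := rule_step_count (pred1 D) h1; have := rule_step_count (pred1 D) h2.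
      rewrite /= !count_cat /= !eqxx !neqs.
      have /count_memPn-> : D \notin lword s by rewrite notin_lword ?neqs.
      have /count_memPn-> : D \notin rword r by rewrite notin_rword // !inE eqxx orbT.
      by rewrite !addn0 => ->; lia.
    * have := rule_step_count (pred1 A) h1; have := rule_step_count (pred1 A) h2.
      rewrite /= !count_cat /= !eqxx !neqs !addn0 => e1 e2.
      have {}e1 : count_mem A y' + 1 = count_mem A z := e1.
      have {}e2 : count_mem A z =
        count_mem A (lword s) + 1 + (1 + count_mem A (rword r)) := e2.
      apply/eqP; rewrite -(eqn_add2r 1) e1 e2 [1 + _]addnC addnA.
      by rewrite [_ + 1 + count_mem _ _]addnAC.
    * rewrite (rule_step_filter0 nA h2) (rule_step_filter0 nD h1).
      by rewrite !filter_cat /= !inE !eqxx !orbT cats0.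
(* With nothing on the left only [m_right2] applies, and it leaves a [B] at the head of the right
   side. *)
- move=> v Dv hv; case/(cstep_DD (u := [::]) isT Dv)=> [[ha]|[] //|[]]; last by rewrite (negbTE hv).
  rewrite /= orbF => hB.
  have hB1 : prefix [:: B] v by move: hB; apply: (@catl_prefix _ [:: B] _ [:: B]).
  case: (pop_outcome (u := [::]) isT Dv _ ha) => [//|[[|] //]|[x e ->]|]; last exact: ReachDead.
  move: Dv hB; rewrite e in_cons negb_or /= => /andP[_ Dx] /andP[_ hx].
  apply: ReachNoLeft => //; case: x hx {Dx e} => //= b x; rewrite prefix0s andbT.
  by move=> /eqP<-; rewrite neqs.
- move=> u v Du Dv hA hB; case/(cstep_DD Du Dv)=> [[ha]|[_]|[]]; rewrite ?(negbTE hA) //.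
  rewrite (negbTE hB) !andbF !orbF; case/orP=> [hu|/(@catl_prefix _ [:: B] v [:: B])]; last first.
    by rewrite (negbTE hB).
  have hu1 : suffix [:: B] u by move: hu; apply: (@catl_suffix _ [:: B]).
  case: (pop_outcome Du Dv _ ha) => [|[x e ->]|[x e ->]|]; last exact: ReachDead.
  + by rewrite hu1.
  + by apply: ReachNoRight => //; move: Du; rewrite e mem_cat negb_or => /andP[].
  + by move: hB; rewrite e /= eqxx prefix0s.
- by move=> w /dead_cstep h /h; exact: ReachDead.
(* Between marking and collapsing, [DDD] forbids the pops, and no [D] is followed by [A]; only the
   collapse is possible. *)
- move=> p s q r c; have [os or] := consumed_ok c.
  have Du : D \notin lword s by rewrite notin_lword ?neqs.
  have Dv : D \notin rword r by rewrite notin_rword // !inE eqxx orbT.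
  have [DA DB] : D != A /\ D != B by rewrite !neqs.
  case/cstep_inv=> [[]|[+ _ _]|[_]|[+ _ _]].
  + by rewrite cutD //= !eqxx.
  + by rewrite !infixE //= !neqs !andbF.
  + rewrite -[D :: D :: D :: D :: _]/(nseq 4 D ++ rword r).
    case=> z [/(rule_step_erase_run Du Dv)-> [y' [+ <-]]].
    by move/(rule_step_erase_run Du Dv)->; exact: reach_two c.
  + by rewrite !infixE //= !neqs (rword_head or).
- by move=> w [_ st] /st.
- move=> k p i s q j r w c hk cD cA hf h.
  have nDD : ~~ infix [:: D; D] w by apply/negP => /infix_count2; lia.
  have [Dw eD eA Aw [_ ef]] := cstep_noDD nDD h.
  have k1 : k = 1 by move: Dw; rewrite -has_pred1 has_count; lia.
  by apply: (@ReachFinish 0 _ _ _ _ _ _ _ c); rewrite ?eD ?eA ?ef //; lia.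
Qed.

(** Every shape but [ReachFinish] with [k = 0] contains a [D] or a [B]. In that one, a word without
    [A] forces by counting that no block is left on either side. *)
Lemma reach_terminal w : reach w -> all (fun a => a \notin [:: S; A; B; D]) w ->
  exists js ws, [/\ ri = map inl js ++ map inr ws, all2 compat ls js & w = ws].
Proof.
have notc c x : c \in [:: S; A; B; D] -> c \in x ->
    ~~ all (fun a => a \notin [:: S; A; B; D]) x.
  by move=> hc cx; apply/allPn; exists c; rewrite ?hc.
have SD : D \in [:: S; A; B; D] by rewrite !inE eqxx !orbT.
move=> h ht; have Dw : D \notin w.
  by apply/negP => /(notc _ _ SD); rewrite ht.
case: h ht Dw => {w}; try by move=> *; rewrite mem_cat mem_head orbT in Dw.
- move=> p i0 i s q j0 j r _ _ _ _ _.
  by rewrite mem_cat mem_head orbT.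
- by move=> v _ _ _; rewrite mem_head.
- by move=> u v _ _ _ _ _; rewrite mem_cat mem_head orbT.
- move=> w [Bw _ _] ht; suff : false by [].
  by move: (notc B w); rewrite !inE eqxx !orbT ht => /(_ isT Bw).
- by move=> p s q r _ _; rewrite mem_cat mem_head orbT.
- by move=> w [-> _].
move=> k p i s q j r w c _ cD cA hf ht Dw.
have k0 : k = 0 by rewrite -cD; apply/count_memPn.
have Aw : A \notin w by apply/negP => /(notc A w); rewrite !inE eqxx !orbT ht => /(_ isT).
move: cA; rewrite (count_memPn Aw) k0 addn0 => /esym/eqP.
have [os or] := consumed_ok c; case: c => e1 e2 h.
rewrite count_cat addn_eq0 => /andP[cs cr].
have es : s = [::].
  by case: s cs {e1 hf os} => //= k' s; rewrite count_cat /= eqxx; lia.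
move: hf; rewrite es /=.
have [ws er] : exists ws, r = map inr ws.
  elim: r cr {e2 or} => [|[j'|a] r IHr] /=; first by exists [::].
    by rewrite /rword /= count_cat count_cat /= eqxx; lia.
  rewrite /rword /= addn_eq0 => /andP[_ /IHr[ws ->]].
  by exists (a :: ws).
have -> : rword r = ws.
  by rewrite er /rword; elim: (ws) => //= a l ->.
have ows : all (fun a => a \notin [:: S; A; B; D]) ws.
  by move: or; rewrite er all_map.
have flt (x : word) : all (fun a => a \notin [:: S; A; B; D]) x ->
    filter (predC (mem [:: A; D])) x = x.
  move=> hx; apply/all_filterP; apply: sub_all hx => a; rewrite !inE !negb_or.
  by case/and4P=> _ -> _ ->.
rewrite !flt // => ->; exists (rcons q j), ws; split=> //.
- by rewrite e2 er.
- by rewrite e1 es cats0.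
Qed.

End Reachable.

End Reduction.

(** * Erasing compatible sequences *)

Section Completeness.
Variables S A B D : symbol.
Hypothesis uSABD : uniq [:: S; A; B; D].

Local Notation neqs := (neqs uSABD).
Local Notation lword := (lword A B).
Local Notation rword := (rword A B).
Local Notation cstep := (cstep A B D).
Local Notation csteps := (clos_refl_trans word cstep).

Lemma cstep_pop u v y : D \notin u -> D \notin v ->
  [|| suffix [:: B; B] u, prefix [:: B; B] v,
      suffix [:: B] u && prefix [:: A] v | suffix [:: A] u && prefix [:: B] v] ->
  rules_apply (pop_rules B D) (u ++ D :: D :: v) y -> cstep (u ++ D :: D :: v) y.
Proof.
move=> Du Dv h ha.
have DAB : (D \notin [:: B; B]) * (D \notin [:: B]) * (D \notin [:: A]).
  by rewrite !inE !neqs.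
have h3 := infix_DDD Du Dv.
case/or4P: h => h.
- exists (m_left2 B D); first by rewrite !inE eqxx.
  split=> // [p [<-]|f [<-]]; last by rewrite h3.
  by rewrite (@infix_DD D [:: B; B] [::]) ?DAB // h prefix0s.
- exists (m_right2 B D); first by rewrite !inE eqxx !orbT.
  split=> // [p [<-]|f [<-]]; last by rewrite h3.
  by rewrite (@infix_DD D [::] [:: B; B]) ?DAB // h suffix0s.
- exists (m_left A B D); first by rewrite !inE eqxx !orbT.
  split=> // [p [<-]|f [<-]]; last by rewrite h3.
  by rewrite (@infix_DD D [:: B] [:: A]) ?DAB.
- exists (m_right A B D); first by rewrite !inE eqxx !orbT.
  split=> // [p [<-]|f [<-]]; last by rewrite h3.
  by rewrite (@infix_DD D [:: A] [:: B]) ?DAB.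
Qed.

Lemma pop_left u v : rules_apply (pop_rules B D) ((u ++ [:: B]) ++ D :: D :: v)
  (u ++ D :: D :: v).
Proof.
exists ((u ++ [:: B]) ++ D :: v); split; first exact: (rule_step_mid D [::]).
exists (u ++ D :: D :: v); split=> //.
by rewrite -catA; exact: (rule_step_mid B [:: D]).
Qed.

Lemma pop_right u v : rules_apply (pop_rules B D) (u ++ D :: D :: B :: v)
  (u ++ D :: D :: v).
Proof.
exists (u ++ D :: B :: v); split; first exact: (rule_step_mid D [::]).
exists (u ++ D :: D :: v); split=> //.
by exists (u ++ [:: D]), v; rewrite -!catA.
Qed.

Lemma csteps_block s i j w : short i -> short j -> compat i j -> D \notin w ->
  csteps ((lword s ++ A :: nseq i B) ++ D :: D :: nseq j B ++ A :: w)
         ((lword s ++ [:: A]) ++ D :: D :: A :: w).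
Proof.
move=> hi hj hij Dw.
have Du n : D \notin lword s ++ A :: nseq n B.
  by rewrite mem_cat in_cons mem_nseq !negb_or (notin_lword (A := A) (B := B)) ?neqs ?andbF.
have Dv n : D \notin nseq n B ++ A :: w.
  by rewrite mem_cat in_cons mem_nseq !negb_or Dw ?neqs ?andbF.
have left n : lword s ++ A :: nseq n.+1 B = (lword s ++ A :: nseq n B) ++ [:: B].
  by rewrite -addn1 nseqD -catA.
have sBB : suffix [:: B; B] (lword s ++ A :: nseq 2 B).
  by rewrite -cat_rcons suffix_suffix.
have pr n : cstep ((lword s ++ A :: nseq 2 B) ++ D :: D :: nseq n.+1 B ++ A :: w)
                  ((lword s ++ A :: nseq 2 B) ++ D :: D :: nseq n B ++ A :: w).
  by apply: cstep_pop; rewrite ?Du ?Dv ?sBB //; exact: pop_right.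
have pl n : cstep ((lword s ++ A :: nseq n.+1 B) ++ D :: D :: nseq 2 B ++ A :: w)
                  ((lword s ++ A :: nseq n B) ++ D :: D :: nseq 2 B ++ A :: w).
  apply: cstep_pop; rewrite ?Du ?Dv //; first by rewrite /= !eqxx orbT.
  by rewrite left; exact: pop_left.
have ql n : cstep ((lword s ++ A :: nseq n.+1 B) ++ D :: D :: A :: w)
                  ((lword s ++ A :: nseq n B) ++ D :: D :: A :: w).
  apply: cstep_pop; rewrite ?Du ?(Dv 0) //.
    by rewrite (suffixB_run uSABD) /= eqxx prefix0s !orbT.
  by rewrite left; exact: pop_left.
have qr n : cstep ((lword s ++ A :: nseq 0 B) ++ D :: D :: nseq n.+1 B ++ A :: w)
                  ((lword s ++ A :: nseq 0 B) ++ D :: D :: nseq n B ++ A :: w).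
  apply: cstep_pop; rewrite ?Du ?Dv //; last exact: pop_right.
  by rewrite (suffixA_run uSABD) /= eqxx prefix0s !orbT.
have tl : csteps ((lword s ++ A :: nseq 2 B) ++ D :: D :: A :: w)
                 ((lword s ++ [:: A]) ++ D :: D :: A :: w).
  by apply: rt_trans (rt_step _ _ _ _ (ql 1)) (rt_step _ _ _ _ (ql 0)).
(* If [i = 2], the [BB] on the left permits emptying the right block first. If [i = 1], the [BB] on
   the right permits erasing the left [B] first. The other block then faces an [A]. *)
have [e|[ei ej]] : i = 2 \/ i = 1 /\ j = 2.
- by move: hi hj hij; rewrite /short /compat; lia.
- rewrite {}e; case: j hj {hij} => [|[|[|j]]] // _.
    by apply: rt_trans (rt_step _ _ _ _ (pr 0)) tl.
  apply: rt_trans (rt_step _ _ _ _ (pr 1)) _.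
  by apply: rt_trans (rt_step _ _ _ _ (pr 0)) tl.
- rewrite ei ej; apply: rt_trans (rt_step _ _ _ _ (pl 0)) _.
  by apply: rt_trans (rt_step _ _ _ _ (qr 1)) (rt_step _ _ _ _ (qr 0)).
Qed.

Lemma csteps_sync u v : D \notin u -> D \notin v ->
  csteps ((u ++ [:: A]) ++ D :: D :: A :: v) (u ++ D :: D :: v).
Proof.
move=> Du Dv; have [DA DB] : D != A /\ D != B by rewrite !neqs.
have DuA : D \notin u ++ [:: A] by rewrite mem_cat negb_or inE neqs Du.
have DAv : D \notin A :: v by rewrite in_cons negb_or neqs Dv.
apply: (rt_trans _ _ _ (u ++ D :: D :: D :: D :: v)); apply: rt_step.
  exists (m_mark A B D); first by rewrite !inE eqxx !orbT.
  split=> [p [<-]|f [<-]|].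
  - rewrite (@infix_DD D [:: A] [:: A]) ?inE //.
    by rewrite suffix1_rcons /= !eqxx prefix0s.
  - by rewrite (infix_BD uSABD) // suffix1_rcons neqs.
  - exists (u ++ D :: D :: D :: A :: v); split.
      by rewrite -catA; exact: (rule_step_mid A [:: D]).
    exists (u ++ D :: D :: D :: D :: v); split=> //.
    by exists (u ++ [:: D; D; D]), v; rewrite -!catA.
exists (m_collapse D); first by rewrite !inE eqxx !orbT.
split=> // [p [<-]|]; first exact: (@infix_infix _ u [:: D; D; D; D] v).
exists (u ++ D :: D :: D :: v); split; first exact: (rule_step_mid D [::]).
exists (u ++ D :: D :: v); split=> //; exact: (rule_step_mid D [::]).
Qed.

(** The first use of [m_finish] must erase the left [A], so that [DA] is still there for the second
    use. *)
Lemma csteps_finish v : D \notin v ->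
  csteps ([:: A] ++ D :: D :: A :: v) v.
Proof.
move=> Dv; have [DA DB] : D != A /\ D != B by rewrite !neqs.
have DAv : D \notin A :: v by rewrite in_cons negb_or neqs Dv.
apply: (rt_trans _ _ _ (D :: A :: v)); apply: rt_step.
  exists (m_finish A B D); first by rewrite !inE eqxx !orbT.
  split=> [p [<-]|f [<-]|].
  - by rewrite (@infix_DA S A B D) ?inE //= eqxx prefix0s.
  - by rewrite (infix_BD uSABD) ?inE // (@suffix1_rcons _ _ [::]) neqs.
  - exists (A :: D :: A :: v); split; first exact: (@rule_step_mid D [::] [:: A]).
    exists (D :: A :: v); split=> //; exact: (@rule_step_mid A [::] [::]).
exists (m_finish A B D); first by rewrite !inE eqxx !orbT.
split=> [p [<-]|f [<-]|].
- exact: (@infix_infix _ [::] [:: D; A] v).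
- by rewrite cutcD0 // (@infix_notin _ D [:: B] [::]).
- exists (A :: v); split; first exact: (@rule_step_mid D [::] [::]).
  by exists v; split=> //; exact: (@rule_step_mid A [::] [::]).
Qed.

(** [p] has to be nonempty, since the marker itself disappears only together with the last pair. *)
Lemma csteps_accept p q ws : p != [::] -> all short p -> all short q ->
  all2 compat p q -> D \notin ws ->
  csteps (lword p ++ D :: D :: rword (map inl q ++ map inr ws)) ws.
Proof.
move=> + + + + Dws; elim: p q => // i p IHp [|j q] //= _ /andP[hi hp] /andP[hj hq] /andP[hij h].
have Drw r : all short r -> D \notin rword (map inl r ++ map inr ws).
  elim: r => [|k r IHr] /=; first by rewrite /rword; elim: (ws) Dws => //= a l IHl; rewrite !inE !negb_or => /andP[-> /IHl].
  case/andP=> _ /IHr h'; rewrite /rword /= mem_cat mem_cat mem_nseq inE !neqs andbF.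
  exact: h'.
have -> : rword (inl j :: map inl q ++ map inr ws) =
  nseq j B ++ A :: rword (map inl q ++ map inr ws) by rewrite /rword /= -catA.
apply: rt_trans (csteps_block _ hi hj hij (Drw _ hq)) _.
case: p q IHp hp hq h => [|i' p] [|j' q] //.
  move=> _ _ _ _; have -> : rword (map inl [::] ++ map inr ws) = ws.
    by rewrite /rword /=; elim: (ws) => //= a l ->.
  exact: csteps_finish.
move=> IHp hp hq h; apply: rt_trans (IHp _ isT hp hq h).
apply: csteps_sync; first by rewrite (notin_lword (A := A) (B := B)) ?neqs.
exact: Drw.
Qed.

End Completeness.

Lemma clos_rt_invariant (T : Type) (R : T -> T -> Prop) (I : T -> Prop) x y :
  (forall x y, I x -> R x y -> I y) -> clos_refl_trans T R x y -> I x -> I y.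
Proof. by move=> h; elim=> {x y} [x y r /h|//|x y z _ h1 _ h2 /h1/h2 //]; apply. Qed.

(** * The SCM grammar of a correspondence *)

Section Correspondence.
Variables (Tok : eqType) (tm : seq (seq Tok * symbol)).
Variables (pm : seq (seq Tok * seq Tok)) (fin : seq Tok).

(** A Post correspondence in two stages: pairs of [tm] write tokens and emit a letter, then pairs of
    [pm] write their first component and read their second; [fin] is read last. The word is reversed
    because each letter is inserted to the left of the earlier ones. *)
Definition corr_lang (w : word) : Prop :=
  exists m1 m2, [/\ {subset m1 <= tm}, {subset m2 <= pm},
    flatten (unzip1 m1) ++ flatten (unzip1 m2) = flatten (unzip2 m2) ++ fin &
    w = rev (unzip2 m1)].

End Correspondence.

(** * Codes of tokens *)

Section Codes.
Variables (Tok : eqType) (toks : seq Tok).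

(* Equal tokens get complementary codes, while for distinct tokens both codes
   have a 1 at the position of the first one. *)
Definition lcode (t : Tok) : seq nat := [seq if x == t then 1 else 2 | x <- toks].
Definition rcode (t : Tok) : seq nat := [seq if x == t then 2 else 1 | x <- toks].
Definition lcodes (X : seq Tok) : seq nat := flatten (map lcode X).
Definition rcodes (X : seq Tok) : seq nat := flatten (map rcode X).

Lemma lcodes_cat X Y : lcodes (X ++ Y) = lcodes X ++ lcodes Y.
Proof. by rewrite /lcodes map_cat flatten_cat. Qed.

Lemma rcodes_cat X Y : rcodes (X ++ Y) = rcodes X ++ rcodes Y.
Proof. by rewrite /rcodes map_cat flatten_cat. Qed.

Lemma short_lcodes X : all short (lcodes X).
Proof.
elim: X => //= t X IHX; rewrite /lcodes /= all_cat -/(lcodes X) IHX andbT.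
by apply/allP => i /mapP[x _ ->]; case: ifP.
Qed.

Lemma short_rcodes X : all short (rcodes X).
Proof.
elim: X => //= t X IHX; rewrite /rcodes /= all_cat -/(rcodes X) IHX andbT.
by apply/allP => i /mapP[x _ ->]; case: ifP.
Qed.

Lemma compat_code s t : t \in toks ->
  all2 compat (lcode t) (rcode s) = (t == s).
Proof.
move=> ht; rewrite all2E !size_map eqxx /=.
rewrite /lcode /rcode zip_map all_map; apply/allP/eqP => [h|<- x _] /=.
  by have := h t ht; rewrite /= eqxx; case: eqP.
by case: ifP.
Qed.

Lemma compat_codes X : all2 compat (lcodes X) (rcodes X).
Proof.
elim: X => //= t X IHX; rewrite /lcodes /rcodes /= all2_cat ?size_map //.
rewrite -/(lcodes X) -/(rcodes X) IHX andbT all2E !size_map eqxx /=.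
rewrite /lcode /rcode zip_map all_map; apply/allP => x _ /=; by case: ifP.
Qed.

(** All codes have length [size toks], so the comparison splits token by token; that length being
    positive, no nonempty token word has an empty code. *)
Lemma compat_codes_eq X Y : toks != [::] -> {subset X <= toks} ->
  all2 compat (lcodes X) (rcodes Y) -> X = Y.
Proof.
move=> t0; elim: X Y => [|a X IHX] [|b Y] //= hX.
- have : rcode b != [::] by rewrite -size_eq0 size_map size_eq0.
  by rewrite /rcodes /=; case: (rcode b).
- have : lcode a != [::] by rewrite -size_eq0 size_map size_eq0.
  by rewrite /lcodes /=; case: (lcode a).
rewrite /lcodes /rcodes /= all2_cat ?size_map // => /andP[].
rewrite compat_code ?hX ?mem_head // => /eqP-> /IHX-> // x hx.
by apply: hX; rewrite in_cons hx orbT.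
Qed.

End Codes.

Section CorrespondenceToSCM.
Variables (Tok : eqType) (toks : seq Tok).
Variables (tm : seq (seq Tok * symbol)) (pm : seq (seq Tok * seq Tok)).
Variables (fin : seq Tok) (T : seq symbol) (eps : bool).

(** By [pm_read] every move of [pm] is visible on the right, which is what forces the moves of [tm]
    to come first. Together with [tm_write] it makes every move leave an [A], so that the rule
    erasing [nS] succeeds only as the very first step. *)
Hypotheses (tm_toks : forall m, m \in tm -> {subset m.1 <= toks})
  (tm_write : forall m, m \in tm -> m.1 != [::])
  (tm_T : forall m, m \in tm -> m.2 \in T)
  (pm_toks : forall m, m \in pm -> {subset m.1 ++ m.2 <= toks})
  (pm_read : forall m, m \in pm -> m.2 != [::])
  (fin_toks : {subset fin <= toks}) (fin0 : fin != [::]).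

Definition fresh : symbol := (\max_(a <- T) a).+1.
Definition nS : symbol := fresh.
Definition nA : symbol := fresh.+1.
Definition nB : symbol := fresh.+2.
Definition nD : symbol := fresh.+3.

Local Notation NN := [:: nS; nA; nB; nD].
Local Notation lword := (lword nA nB).
Local Notation rword := (rword nA nB).
Local Notation item_ok := (item_ok nS nA nB nD).
Local Notation cstep := (cstep nA nB nD).

Lemma uNN : uniq NN.
Proof. by rewrite /= !inE /nS /nA /nB /nD; lia. Qed.

Lemma fresh_gt a : a \in T -> a < fresh.
Proof. by move=> aT; rewrite ltnS; exact: leq_bigmax_seq. Qed.

Lemma T_NN a : a \in T -> a \notin NN.
Proof.
by move/fresh_gt; rewrite !inE /nS /nA /nB /nD => h; apply/negP; lia.
Qed.

(** Lists are reversed because [lword] and [rword] put their head next to the marker, where the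
    token written last belongs. The codes of [fin] come with the marker, as the last ones on the
    right. *)
Definition gen_words : seq word :=
  [seq lword (rev (lcodes toks m.1)) ++ nS :: [:: m.2] | m <- tm] ++
  [seq lword (rev (lcodes toks m.1)) ++
       nS :: rword (rev (map inl (rcodes toks m.2))) | m <- pm] ++
  (nD :: nD :: rword (rev (map inl (rcodes toks fin)))) ::
  (if eps then [:: [::]] else [::]).

Definition gen_matrix (x : word) : matrix := ([:: (nS, x)], (None, None)).

(** [undup] provides the uniqueness demanded by [scm_wf]. *)
Definition corr_scm : scm_grammar := {|
  scm_V := NN ++ undup T;
  scm_T := undup T;
  scm_S := nS;
  scm_M := undup (map gen_matrix gen_words ++ cond_matrices nA nB nD) |}.

Definition move := (seq Tok * (symbol + seq Tok))%type.
Definition all_moves : seq move :=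
  [seq (m.1, inl m.2) | m <- tm] ++ [seq (m.1, inr m.2) | m <- pm].
Definition move_items (o : symbol + seq Tok) : seq item :=
  match o with inl a => [:: inr a] | inr q => map inl (rcodes toks q) end.
Definition gen_left (ms : seq move) : seq nat :=
  lcodes toks (flatten (unzip1 ms)).
Definition gen_right (ms : seq move) : seq item :=
  flatten (map move_items (unzip2 ms)).
Definition gen_form (ms : seq move) : word :=
  lword (rev (gen_left ms)) ++ nS :: rword (rev (gen_right ms)).

Lemma lword_cat s1 s2 : lword (s1 ++ s2) = lword s2 ++ lword s1.
Proof.
by elim: s1 => [|i s1 IHs] /=; rewrite ?cats0 // IHs catA.
Qed.

Lemma rword_cat r1 r2 : rword (r1 ++ r2) = rword r1 ++ rword r2.
Proof. by rewrite /rword map_cat flatten_cat. Qed.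

Lemma gen_form_rcons ms m : gen_form (rcons ms m) =
  lword (rev (gen_left ms)) ++ (lword (rev (lcodes toks m.1)) ++
    nS :: rword (rev (move_items m.2))) ++ rword (rev (gen_right ms)).
Proof.
rewrite /gen_form /gen_left /gen_right /unzip1 /unzip2 !map_rcons !flatten_rcons.
by rewrite lcodes_cat !rev_cat lword_cat rword_cat -!catA.
Qed.

Lemma gen_words_moves x : x \in gen_words <->
  [\/ exists2 m, m \in all_moves & x = lword (rev (lcodes toks m.1)) ++
        nS :: rword (rev (move_items m.2)),
      x = nD :: nD :: rword (rev (map inl (rcodes toks fin))) | eps /\ x = [::]].
Proof.
rewrite /gen_words !mem_cat in_cons; split.
  case/or4P=> [/mapP[m hm ->]|/mapP[m hm ->]|/eqP->|].
  - constructor 1; exists (m.1, inl m.2) => //.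
    by rewrite mem_cat; apply/orP; left; apply/mapP; exists m.
  - constructor 1; exists (m.1, inr m.2) => //.
    by rewrite mem_cat; apply/orP; right; apply/mapP; exists m.
  - by constructor 2.
  - by case: eps => //; rewrite inE => /eqP->; constructor 3.
case=> [[m + ->]|->|[-> ->]].
- rewrite mem_cat => /orP[]/mapP[m' hm' ->] /=; apply/orP; [left|right].
    by apply/mapP; exists m'.
  by apply/orP; left; apply/mapP; exists m'.
- by rewrite eqxx !orbT.
- by rewrite inE eqxx !orbT.
Qed.

Lemma gen_left_ok ms : all short (rev (gen_left ms)).
Proof. by rewrite all_rev short_lcodes. Qed.

Lemma all_item_ok_inl js : all item_ok (map inl js) = all short js.
Proof. by rewrite all_map. Qed.

Lemma gen_right_ok ms : {subset ms <= all_moves} -> all item_ok (gen_right ms).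
Proof.
elim: ms => //= -[p o] ms IHms hms; rewrite /gen_right /= all_cat.
apply/andP; split; last by apply: IHms => m hm; rewrite hms // in_cons hm orbT.
case: o hms => [a|q] hms /=; last by rewrite all_item_ok_inl short_rcodes.
have := hms _ (mem_head _ _); rewrite mem_cat andbT.
by case/orP=> /mapP[m hm [] // _ ->]; rewrite T_NN // tm_T.
Qed.

Lemma gen_final_ok ms : {subset ms <= all_moves} ->
  all item_ok (rev (gen_right ms ++ map inl (rcodes toks fin))).
Proof.
by move=> h; rewrite all_rev all_cat gen_right_ok //= all_item_ok_inl short_rcodes.
Qed.

(** Still generating; erasing; or [nS] gone without a marker, by the rule for the empty word. *)
Definition scm_reach (x : word) : Prop :=
  exists2 ms, {subset ms <= all_moves} &
  [\/ x = gen_form ms,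
      nS \notin x /\ reach nA nB nD (rev (gen_left ms))
        (rev (gen_right ms ++ map inl (rcodes toks fin))) x |
      eps /\ x = lword (rev (gen_left ms)) ++ rword (rev (gen_right ms))].

(** Every permitting word contains [nD], so erasing cannot start before the marker is generated. *)
Lemma cstep_D x y : cstep x y -> nD \in x.
Proof.
have hin a b : infix (a ++ nD :: b) x -> nD \in x.
  by case/infixP=> s [t ->]; rewrite !mem_cat in_cons eqxx !orbT.
case/cstep_inv=> [[_ _ /infix_pop_DD/(hin [::])]|[/(hin [:: nA])]|[/(hin [::])]|[/(hin [::])]] //.
Qed.

Lemma cstep_notinS x y : nS \notin x -> cstep x y -> nS \notin y.
Proof.
have [[SA SB] SD] : ((nS == nA) = false /\ (nS == nB) = false) /\ (nS == nD) = false.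
  by rewrite !(neqs uNN).
have hr (R : seq (symbol * word)) z z' : all (fun r => nS \notin r.2) R ->
    rules_apply R z z' -> nS \notin z -> nS \notin z'.
  elim: R z => [|[c w] R IHR] z /=; first by move=> _ ->.
  case/andP=> hw hR [z1 [[u [v [/= -> ->]]] /(IHR _ hR) h]].
  rewrite !mem_cat in_cons !negb_or => /and3P[h1 _ h2]; apply: h.
  by rewrite !mem_cat !negb_or h1 h2 hw.
move=> hx [r hr' [_ _ /hr]]; apply=> //; move: hr'; rewrite !inE.
by do ![case/orP=> [/eqP-> /=|]|move/eqP-> => /=]; rewrite ?inE ?SA ?SB ?SD.
Qed.

Lemma scm_step_cases x y : scm_step corr_scm x y ->
  (exists2 w, w \in gen_words & rule_step (nS, w) x y) \/ cstep x y.
Proof.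
case=> r; rewrite mem_undup mem_cat => /orP[/mapP[w hw ->]|hr h]; last by right; exists r.
by case=> _ _ [z [h <-]]; left; exists w.
Qed.

Lemma notin_items c r : c \in [:: nS; nD] -> all item_ok r -> c \notin rword r.
Proof. by move=> hc hr; rewrite (notin_rword uNN hr hc). Qed.

Lemma notin_left c s : c \in [:: nS; nD] -> c \notin lword s.
Proof.
by rewrite !inE => /orP[]/eqP->; rewrite notin_lword ?(neqs uNN).
Qed.

Lemma rule_step_uniq c w p q y : c \notin p -> c \notin q ->
  rule_step (c, w) (p ++ c :: q) y -> y = p ++ w ++ q.
Proof.
move=> cp cq /rule_step_cat[[p' /(rule_step_notin cp)] //|[q' h ->]].
by case/rule_step_cons: h => [[_ ->] //|[q2 /(rule_step_notin cq)]].
Qed.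

Lemma scm_reach_step x y : scm_reach x -> scm_step corr_scm x y -> scm_reach y.
Proof.
have SS : nS \in [:: nS; nD] by rewrite inE eqxx.
have DS : nD \in [:: nS; nD] by rewrite !inE eqxx orbT.
move=> [ms hms]; have Slm := notin_left (rev (gen_left ms)) SS.
have orm : all item_ok (rev (gen_right ms)) by rewrite all_rev gen_right_ok.
have Srm := notin_items SS orm.
case=> [->|[Sx hx]|[he ->]] /scm_step_cases[[w hw h]|h].
- have {h} -> := rule_step_uniq Slm Srm h.
  case/gen_words_moves: hw => [[m hm ->]|->|[he ->]].
  + exists (rcons ms m); last by constructor 1; rewrite gen_form_rcons.
    by move=> m'; rewrite mem_rcons in_cons => /predU1P[->|/hms].
  + exists ms => //; constructor 2; split.
      rewrite !(mem_cat, in_cons) !negb_or Slm Srm !(neqs uNN) /= andbT.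
      by apply: notin_items => //; rewrite -map_rev all_item_ok_inl all_rev short_rcodes.
    have := @reach_two nS nA nB nD uNN _ _ (gen_left_ok ms) (gen_final_ok hms)
      [::] (rev (gen_left ms)) [::] _ (And3 erefl erefl isT).
    by rewrite rev_cat rword_cat.
  + by exists ms => //; constructor 3.
- have := cstep_D h; rewrite mem_cat in_cons (negbTE (notin_left _ DS)).
  by rewrite (negbTE (notin_items DS orm)) (neqs uNN).
- by case: h => u [v [/= e _]]; move: Sx; rewrite e mem_cat mem_head orbT.
- exists ms => //; constructor 2; split; first exact: cstep_notinS h.
  exact: (reach_cstep uNN (gen_left_ok ms) (gen_final_ok hms) hx h).
- case: h => u [v [/= e _]]; suff : nS \in u ++ nS :: v by rewrite -e mem_cat (negbTE Slm) (negbTE Srm).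
  by rewrite mem_cat mem_head orbT.
- have := cstep_D h; rewrite mem_cat (negbTE (notin_left _ DS)).
  by rewrite (negbTE (notin_items DS orm)).
Qed.

Lemma rcodes_nil q : rcodes toks q = [::] -> toks != [::] -> q = [::].
Proof.
case: q => // t q; rewrite /rcodes /= => e t0.
have : rcode toks t != [::] by rewrite -size_eq0 size_map size_eq0.
by case: rcode e.
Qed.

Lemma toks0 : toks != [::].
Proof.
by case: fin fin0 fin_toks => // t f _ /(_ t (mem_head _ _)); case: toks.
Qed.

(** The outermost entry on the right tells the kind of the first move, as each [pm] move contributes
    a block. Letters outside blocks therefore mean [tm] moves before [pm] moves. *)
Lemma gen_right_split ms F W J : {subset ms <= all_moves} ->
  gen_right ms ++ map inl F = map inr W ++ map inl J ->
  exists m1 m2, [/\ {subset m1 <= tm}, {subset m2 <= pm},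
    flatten (unzip1 ms) = flatten (unzip1 m1) ++ flatten (unzip1 m2),
    unzip2 m1 = W & J = rcodes toks (flatten (unzip2 m2)) ++ F].
Proof.
elim: ms W J => [|[p o] ms IHms] W J hms.
  rewrite /gen_right /=; case: W => [|a W] /=; last by case: F.
  move=> e; have {e} <- : F = J.
    by elim: F J e => [|f F IHF] [|j J] //= [-> /IHF->].
  by exists [::], [::].
have hms' : {subset ms <= all_moves} by move=> m hm; rewrite hms // in_cons hm orbT.
have := hms _ (mem_head _ _); rewrite mem_cat /gen_right /= => /orP[]/mapP[m hm [-> ->]] /=.
  case: W => [|a W] /=; first by case: J.
  case=> <- /(IHms _ _ hms')[m1 [m2 [h1 h2 -> <- ->]]].
  exists (m :: m1), m2; split=> //; rewrite /= ?catA //.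
  by move=> m'; rewrite in_cons => /predU1P[->|/h1].
rewrite -catA.
have : rcodes toks m.2 != [::].
  by apply/eqP => /rcodes_nil /(_ toks0) e; have := pm_read hm; rewrite e.
case: W => [|a W] /=; last by case: rcodes.
move=> _ e.
have [J' [eJ e']] : exists J', J = rcodes toks m.2 ++ J' /\
    gen_right ms ++ map inl F = map inr [::] ++ map inl J'.
  elim: (rcodes toks m.2) J e => [|c q IHq] J /=; first by exists J.
  by case: J => [|j J] //= [<- /IHq[J' [-> h]]]; exists J'.
case: (IHms _ _ hms' e') => [[|m1 m1s] [m2 [h1 h2 h3 // _ h4]]].
exists [::], (m :: m2); split=> //; rewrite ?h3 //=.
  by move=> m'; rewrite in_cons => /predU1P[->|/h2].
by rewrite eJ h4 rcodes_cat catA.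
Qed.

Lemma memA_lword s : s != [::] -> nA \in lword s.
Proof. by case: s => //= i s _; rewrite mem_cat mem_head orbT. Qed.

Lemma memA_rword r j : inl j \in r -> nA \in rword r.
Proof.
move=> hj; apply/flattenP; exists (item_word nA nB (inl j)).
  by apply/mapP; exists (inl j).
by rewrite mem_cat mem_head orbT.
Qed.

Lemma scm_reach_terminal w : scm_reach w -> word_over (undup T) w ->
  (eps /\ w = [::]) \/ corr_lang tm pm fin w.
Proof.
move=> [ms hms hw] hT.
have {}hT : all (fun a => a \notin NN) w.
  by apply/allP => a /(allP hT); rewrite mem_undup; exact: T_NN.
have notA x : nA \in x -> ~~ all (fun a => a \notin NN) x.
  by move=> Ax; apply/allPn; exists nA; rewrite // !inE eqxx orbT.
case: hw => [e|[_ h]|[he e]].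
- move: hT; rewrite e all_cat => /andP[_ /=].
  by rewrite !inE eqxx.
- right; have [js [ws [e1 e2 ->]]] := reach_terminal uNN (gen_left_ok ms) (gen_final_ok hms) h hT.
  move/(congr1 rev): e1; rewrite revK rev_cat -!map_rev => /(gen_right_split hms).
  case=> m1 [m2 [h1 h2 h3 h4 h5]].
  have e2' : all2 compat (gen_left ms) (rev js).
    move: e2; rewrite !all2E size_rev => /andP[/eqP es].
    rewrite -[js in zip _ js]revK -rev_zip ?size_rev // all_rev.
    by rewrite es eqxx.
  exists m1, m2; split=> //; last by rewrite h4 revK.
  rewrite h5 -rcodes_cat /gen_left h3 in e2'.
  apply: (compat_codes_eq toks0 _ e2') => t.
  rewrite mem_cat => /orP[]/flattenP[X /mapP[m hm ->]].
    exact: (tm_toks (h1 _ hm)).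
  by move=> ht; apply: (pm_toks (h2 _ hm)); rewrite mem_cat ht.
(* Any move would have left an [A], which is not a terminal. *)
- left; split=> //; case: ms hms e => [|m ms] hms e; first by rewrite e.
  suff /notA : nA \in w by rewrite hT.
  rewrite e mem_cat; apply/orP; have := hms _ (mem_head _ _).
  rewrite mem_cat => /orP[]/mapP[m' hm' em]; [left|right].
    apply: memA_lword; rewrite -size_eq0 size_rev size_eq0 em /gen_left /=.
    have := tm_write hm'; case: m'.1 => //= t p _.
    have : lcode toks t != [::] by rewrite -size_eq0 size_map size_eq0 toks0.
    by rewrite /lcodes /=; case: lcode.
  have : rcodes toks m'.2 != [::].
    by apply/eqP => /rcodes_nil /(_ toks0) e0; have := pm_read hm'; rewrite e0.
  case er : (rcodes toks m'.2) => [|j js] // _; apply: (@memA_rword _ j).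
  by rewrite mem_rev em /gen_right /= mem_cat er mem_head.
Qed.

Lemma csteps_scm x y : clos_refl_trans _ cstep x y ->
  clos_refl_trans _ (scm_step corr_scm) x y.
Proof.
elim=> {x y} [x y [r hr h]|x|x y z _ h1 _ h2].
- by apply: rt_step; exists r => //; rewrite mem_undup mem_cat hr orbT.
- exact: rt_refl.
- exact: rt_trans h1 h2.
Qed.

Lemma gen_step p q x : x \in gen_words ->
  scm_step corr_scm (p ++ nS :: q) (p ++ x ++ q).
Proof.
move=> hx; exists (gen_matrix x).
  by rewrite mem_undup mem_cat map_f.
by split=> //; exists (p ++ x ++ q); split=> //; exact: rule_step_mid.
Qed.

Lemma gen_reachable ms : {subset ms <= all_moves} ->
  clos_refl_trans _ (scm_step corr_scm) [:: nS] (gen_form ms).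
Proof.
elim/last_ind: ms => [|ms m IHms] hms; first exact: rt_refl.
apply: rt_trans (IHms _) (rt_step _ _ _ _ _).
  by move=> m' h; rewrite hms // mem_rcons in_cons h orbT.
rewrite gen_form_rcons; apply: gen_step; apply/gen_words_moves; constructor 1.
by exists m => //; rewrite hms // mem_rcons mem_head.
Qed.

Lemma corr_lang_scm w : corr_lang tm pm fin w -> scm_lang corr_scm w.
Proof.
case=> m1 [m2 [h1 h2 e ew]].
have hw : {subset w <= T}.
  move=> a; rewrite ew mem_rev => /mapP[m hm ->]; exact: tm_T (h1 _ hm).
split; first by apply/allP => a /hw; rewrite mem_undup.
pose ms : seq move := [seq (m.1, inl m.2) | m <- m1] ++ [seq (m.1, inr m.2) | m <- m2].
have hms : {subset ms <= all_moves}.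
  move=> m; rewrite !mem_cat => /orP[]/mapP[m' hm' ->]; apply/orP; [left|right].
    by apply/mapP; exists m' => //; exact: h1.
  by apply/mapP; exists m' => //; exact: h2.
apply: rt_trans (gen_reachable hms) _.
pose x := nD :: nD :: rword (rev (map inl (rcodes toks fin))).
apply: (rt_trans _ _ _ (lword (rev (gen_left ms)) ++ x ++ rword (rev (gen_right ms)))).
  by apply/rt_step/gen_step/gen_words_moves; constructor 2.
rewrite /x !cat_cons -rword_cat -rev_cat; apply: csteps_scm.
have eL : gen_left ms = lcodes toks (flatten (unzip2 m2) ++ fin).
  by rewrite /gen_left /ms /unzip1 map_cat -!map_comp flatten_cat -e /unzip1.
have eR : gen_right ms ++ map inl (rcodes toks fin) =
    map inr (unzip2 m1) ++ map inl (rcodes toks (flatten (unzip2 m2) ++ fin)).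
  rewrite /gen_right /ms /unzip2 map_cat -!map_comp map_cat flatten_cat -catA.
  rewrite rcodes_cat map_cat; congr (_ ++ (_ ++ _)).
    rewrite -map_comp; elim: (m1) => //= m l ->; by [].
  by elim: (m2) => //= m l IHl; rewrite -map_comp /= rcodes_cat map_cat -IHl -map_comp.
rewrite eR rev_cat -(map_rev inr) -(map_rev inl) -ew eL; set X := _ ++ fin.
apply: (csteps_accept uNN).
- rewrite -size_eq0 size_rev size_eq0 /X lcodes_cat.
  case: (fin) fin0 => // t f _.
  have : lcode toks t != [::] by rewrite -size_eq0 size_map size_eq0 toks0.
  by rewrite /lcodes /=; case: lcode => // i c _; case: flatten.
- by rewrite all_rev short_lcodes.
- by rewrite all_rev short_rcodes.
- have := compat_codes toks X; rewrite !all2E !size_rev => /andP[/eqP es].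
  by rewrite es eqxx -rev_zip // all_rev.
- by apply/negP => /hw/T_NN; rewrite !inE eqxx !orbT.
Qed.

Lemma corr_scm_lang w :
  scm_lang corr_scm w <-> (eps /\ w = [::]) \/ corr_lang tm pm fin w.
Proof.
split=> [[hT h]|[[he ->]|]]; last exact: corr_lang_scm.
- apply: scm_reach_terminal hT; apply: (clos_rt_invariant scm_reach_step h).
  by exists [::] => //; constructor 1.
- split=> //; apply: rt_step; apply: (@gen_step [::] [::] [::]).
  by apply/gen_words_moves; constructor 3.
Qed.

(** * Well-formedness and size of the constructed grammar *)

Lemma scm_N_corr : scm_N corr_scm = NN.
Proof.
rewrite /scm_N /= !mem_undup.
have h a : a \in NN -> a \in T = false.
  by move=> hN; apply/negP => /T_NN; rewrite hN.
rewrite !h ?inE ?eqxx ?orbT //= -[RHS]cats0; congr [:: _, _, _, _ & _].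
rewrite -(filter_pred0 (undup T)); apply: eq_in_filter => a.
by rewrite mem_undup => ->.
Qed.

Lemma scm_wf_corr : scm_wf corr_scm.
Proof.
have hT a : a \in T -> a \in scm_V corr_scm by move=> aT; rewrite mem_cat mem_undup aT orbT.
have hN a : a \in NN -> a \in scm_V corr_scm by move=> aN; rewrite mem_cat aN.
have wl s : word_over (scm_V corr_scm) (lword s).
  by apply/allP => a /mem_lword[] ->; apply: hN; rewrite !inE eqxx ?orbT.
have wr r : all (fun x => if x is inr a then a \in T else true) r ->
    word_over (scm_V corr_scm) (rword r).
  elim: r => //= c r IHr /andP[hc /IHr h]; rewrite /rword /= /word_over all_cat.
  apply/andP; split=> //; case: c hc => [j _|a] /=; last by rewrite andbT; exact: hT.
  rewrite all_cat all_nseq /= !hN ?orbT // !inE eqxx ?orbT //.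
have wri js : word_over (scm_V corr_scm) (rword (rev (map inl js))).
  by apply: wr; rewrite all_rev all_map; exact/allP.
split; last split; last split; last split; last split; last split.
- rewrite cat_uniq uNN undup_uniq /= andbT; apply/hasPn => a.
  by rewrite mem_undup; exact: T_NN.
- exact: undup_uniq.
- by apply/allP => a; rewrite mem_undup; exact: hT.
- apply/hasP; exists nS; first by rewrite mem_head.
  by rewrite mem_undup; apply/negP => /T_NN; rewrite mem_head.
- by rewrite scm_N_corr mem_head.
- exact: undup_uniq.
- apply/allP => r; rewrite mem_undup mem_cat => /orP[/mapP[x hx ->]|].
    rewrite /= scm_N_corr mem_head /= !andbT.
    case/gen_words_moves: hx => [[m hm ->]|->|[_ -> //]].
      rewrite /word_over all_cat /= -!/(word_over _ _) wl hN ?mem_head //=.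
      move: hm; rewrite mem_cat => /orP[]/mapP[m' hm' ->].
        by apply: (wr [:: inr m'.2]); rewrite /= (tm_T hm').
      exact: wri.
    by rewrite /= wri !hN // !inE eqxx !orbT.
  have nn : all (fun a => a \in scm_V corr_scm) NN by apply/allP.
  case/and5P: nn => hS hA hB hD _.
  rewrite !inE; do ![case/orP=> [/eqP->|]|move/eqP->];
    rewrite /= /word_over /= scm_N_corr ?hA ?hB ?hD // !inE !eqxx !orbT //.
Qed.

Theorem corr_lang_in_SCM (L : language) :
  (forall w, L w <-> (eps /\ w = [::]) \/ corr_lang tm pm fin w) ->
  in_SCM 4 3 4 7 2 6 L.
Proof.
move=> hL; exists corr_scm; split; first exact: scm_wf_corr.
(* Generating matrices are unconditional, so both counts reduce to the seven fixed matrices. *)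
have hgen (a : pred matrix) : (forall x, ~~ a (gen_matrix x)) ->
    count a (scm_M corr_scm) <= count a (cond_matrices nA nB nD).
  move=> ha; apply: leq_trans (count_undup _ _) _; rewrite count_cat.
  by rewrite count_map (eq_count (a2 := pred0)) ?count_pred0 // => x; apply/negbTE/ha.
split; last split; last split; last split; last split.
- apply/allP => r; rewrite mem_undup mem_cat => /orP[/mapP[x _ ->] //|].
  by rewrite !inE; do ![case/orP=> [/eqP-> //|]|move/eqP->].
- by rewrite scm_N_corr.
- exact: leq_trans (hgen _ _) _.
- apply/allP => r; rewrite mem_undup mem_cat => /orP[/mapP[x _ ->] //|].
  by rewrite !inE; do ![case/orP=> [/eqP-> //|]|move/eqP->].
- exact: leq_trans (hgen _ _) _.
- by move=> w; rewrite hL; split=> /corr_scm_lang.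
Qed.

End CorrespondenceToSCM.

(** * Histories of type-0 derivations as correspondences *)

Section PhraseStructureToCorrespondence.
Variable G : ps_grammar.
Hypothesis wfG : ps_wf G.

Local Notation V := (ps_V G).
Local Notation T := (ps_T G).
Local Notation derives := (clos_refl_trans _ (ps_step G)).

(* [None] separates the successive sentential forms of the history, [Some (inl a)]
   is a letter of the generated word and [Some (inr c)] one of a sentential form. *)
Definition tok := option (symbol + symbol).
Definition hash : tok := None.
Definition plain (a : symbol) : tok := Some (inl a).
Definition bar (c : symbol) : tok := Some (inr c).

(* Productions read backwards on reversed sentential forms; an erasing production
   borrows a neighbouring letter so that no right component is empty. *)
Definition rev_pairs : seq (word * word) :=
  [seq ([:: c], [:: c]) | c <- V] ++
  [seq (rev uv.1, rev uv.2) | uv <- ps_P G & uv.2 != [::]] ++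
  [seq (c :: rev uv.1, [:: c]) | uv <- [seq uv <- ps_P G | uv.2 == [::]], c <- V] ++
  [seq (rcons (rev uv.1) c, [:: c]) | uv <- [seq uv <- ps_P G | uv.2 == [::]], c <- V].

(** The right component is read from one sentential form, the left one is written into the form
    preceding it in the derivation. [hash] is always read together with a barred letter, which
    excludes a plain letter after it. *)
Definition hist_pm : seq (seq tok * seq tok) :=
  [seq ([:: bar a], [:: plain a]) | a <- T] ++
  [seq (map bar pq.1, map bar pq.2) | pq <- rev_pairs] ++
  [seq (hash :: map bar pq.1, hash :: map bar pq.2) | pq <- rev_pairs].

(** Pairs of the second kind end the word with [hash]. That exactly one is used, for the letter
    emitted last, is enforced by the correspondence. *)
Definition hist_tm : seq (seq tok * symbol) :=
  [seq ([:: plain a], a) | a <- T] ++ [seq ([:: plain a; hash], a) | a <- T].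

Definition hist_fin : seq tok := [:: hash; bar (ps_S G)].

Definition hist_toks : seq tok := hash :: map plain T ++ map bar V.

Lemma mem_hist_pm m : m \in hist_pm ->
  [\/ exists2 a, a \in T & m = ([:: bar a], [:: plain a]),
      exists2 pq, pq \in rev_pairs & m = (map bar pq.1, map bar pq.2) |
      exists2 pq, pq \in rev_pairs & m = (hash :: map bar pq.1, hash :: map bar pq.2)].
Proof.
rewrite !mem_cat => /or3P[]/mapP[a ha ->].
- by constructor 1; exists a.
- by constructor 2; exists a.
- by constructor 3; exists a.
Qed.

Lemma rev_pairsP p q : (p, q) \in rev_pairs ->
  q != [::] /\ forall a b, derives (rev (a ++ p ++ b)) (rev (a ++ q ++ b)).
Proof.
have st a b u v : (u, v) \in ps_P G -> derives (rev b ++ u ++ rev a) (rev b ++ v ++ rev a).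
  by move=> h; apply: rt_step; exists (u, v) => //; exists (rev b), (rev a).
rewrite !mem_cat => /or4P[/mapP[c _ [-> ->]]|/mapP[[u v]]|/allpairsP[[[u v] c]]|/allpairsP[[[u v] c]]] /=.
- by split=> // a b; exact: rt_refl.
- rewrite mem_filter /= => /andP[v0 h] [-> ->]; split.
    by rewrite -size_eq0 size_rev size_eq0.
  by move=> a b; rewrite !rev_cat !revK -!catA; exact: st.
- rewrite mem_filter /= => -[/andP[/eqP v0 h] _ [-> ->]]; rewrite v0 in h.
  split=> // a b; have := st (rcons a c) b u [::] h.
  have -> : a ++ (c :: rev u) ++ b = rcons a c ++ rev u ++ b by rewrite cat_rcons.
  have -> : a ++ [:: c] ++ b = rcons a c ++ b by rewrite cat_rcons.
  by rewrite !rev_cat revK -!catA.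
- rewrite mem_filter /= => -[/andP[/eqP v0 h] _ [-> ->]]; rewrite v0 in h.
  split=> // a b; have := st a (c :: b) u [::] h.
  have -> : a ++ rcons (rev u) c ++ b = a ++ rev u ++ c :: b by rewrite cat_rcons.
  rewrite -[[:: c] ++ b]/(c :: b).
  by rewrite !rev_cat revK -!catA.
Qed.

(** Since [y] is nonempty, an erasing production can borrow the letter after it or, at the end of
    the word, the one before it. *)
Lemma rev_pairs_complete x y : word_over V y -> y != [::] -> ps_step G x y ->
  exists a p q b, [/\ (p, q) \in rev_pairs, rev x = a ++ p ++ b & rev y = a ++ q ++ b].
Proof.
move=> oy y0 [[u v] huv [l [r [/= -> ey]]]]; rewrite {}ey in oy y0 *.
case: (eqVneq v [::]) => [ev|v0]; last first.
  exists (rev r), (rev u), (rev v), (rev l); split; rewrite ?rev_cat -?catA //.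
  rewrite !mem_cat; apply/orP; right; apply/orP; left.
  by apply/mapP; exists (u, v) => //; rewrite mem_filter v0.
have hf : (u, v) \in [seq uv <- ps_P G | uv.2 == [::]] by rewrite mem_filter huv ev eqxx.
rewrite {}ev /= in oy y0 hf *; case: r oy y0 => [|c r] oy y0.
  case/lastP: l oy y0 => [//|l c]; rewrite !cats0 => oy _.
  exists [::], (rcons (rev u) c), [:: c], (rev l).
  split; rewrite ?rev_cat ?rev_rcons ?cat_rcons //.
  rewrite !mem_cat; do 3!(apply/orP; right).
  apply/allpairsP; exists ((u, [::]), c); split=> //=.
  by apply: (allP oy); rewrite mem_rcons mem_head.
exists (rev r), (c :: rev u), [:: c], (rev l).
split; rewrite ?rev_cat ?rev_cons ?cat_rcons -?catA //.
rewrite !mem_cat; do 2!(apply/orP; right); apply/orP; left.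
apply/allpairsP; exists ((u, [::]), c); split=> //=.
by apply: (allP oy); rewrite mem_cat mem_head orbT.
Qed.

Definition strip (t : tok) : symbol :=
  match t with Some (inl a) => a | Some (inr a) => a | None => 0 end.

Lemma strip_bar x : map strip (map bar x) = x.
Proof. by rewrite -map_comp; elim: x => //= a x ->. Qed.

Lemma hash_bar x : hash \notin map bar x.
Proof. by apply/mapP => -[]. Qed.

Lemma hash_prefix (X Y u v : seq tok) : hash \notin Y -> X ++ hash :: u = Y ++ v ->
  exists2 X', X = Y ++ X' & v = X' ++ hash :: u.
Proof.
elim: Y X => [|y Y IHY] X /=; first by move=> _ <-; exists X.
rewrite inE negb_or => /andP[hy /IHY h]; case: X => [|x X] /=.
  by case=> e; rewrite e eqxx in hy.
by case=> -> /h[X' -> ->]; exists X'.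
Qed.

(** [X] is the unread rest of a form and [y] the part of its predecessor written so far, so
    [y ++ map strip X] is a reversed form lying between the two. One pass over a form may apply any
    number of productions. *)
Lemma history_sound m2 X y : {subset m2 <= hist_pm} -> hash \notin X ->
  X ++ hash :: map bar y ++ flatten (unzip1 m2) = flatten (unzip2 m2) ++ hist_fin ->
  derives [:: ps_S G] (rev (y ++ map strip X)).
Proof.
elim: m2 X y => [|m m2 IHm] X y hm hX /=.
  case: X hX => [_ [/esym] |x X]; last by rewrite inE negb_or => /andP[/eqP hx _] [/esym].
  case: y => [|c [|d y]] //= [->]; exact: rt_refl.
have hm' : {subset m2 <= hist_pm} by move=> m' h; rewrite hm // in_cons h orbT.
case: (mem_hist_pm (hm _ (mem_head _ _))) => [[a aT ->]|[[p q] hpq ->]|[[p q] hpq ->]] /=.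
- case: X hX => [|x X] //=; rewrite inE negb_or => /andP[_ hX] [-> e].
  have := IHm X (rcons y a) hm' hX; rewrite map_rcons cat_rcons e => /(_ erefl).
  by rewrite cat_rcons.
- have [_ hd] := rev_pairsP hpq; rewrite -catA.
  move/(hash_prefix (hash_bar _))=> [X' eX e]; rewrite {}eX in hX *.
  have hX' : hash \notin X' by move: hX; rewrite mem_cat negb_or => /andP[].
  rewrite map_cat strip_bar; apply: rt_trans (hd y (map strip X')).
  by have := IHm X' (y ++ p) hm' hX'; rewrite map_cat -!catA e; apply.
- case: X hX => [_|x X]; last by rewrite inE negb_or => /andP[/eqP hx _] [/esym].
  rewrite /= -catA => -[] /(hash_prefix (hash_bar _))[X' ey e].
  have [_ hd] := rev_pairsP hpq.
  (* After [hash], the form being read is [y], so its unread rest is barred. *)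
  have [y' eX'] : exists y', X' = map bar y'.
    have e' : drop (size q) (map bar q ++ X') = X' by rewrite -(size_map bar q) drop_size_cat.
    by exists (drop (size q) y); rewrite map_drop ey e'.
  have {ey} -> : y = q ++ y' by rewrite -[y]strip_bar ey eX' map_cat !strip_bar.
  rewrite cats0; apply: rt_trans (hd [::] y').
  by have := IHm X' p hm'; rewrite eX' strip_bar e eX'; apply=> //; exact: hash_bar.
Qed.

(** The displayed [hash] has to be read by a pair or by [hist_fin], and in both a barred letter
    follows it. *)
Lemma history_plain_after_hash m2 X b R : {subset m2 <= hist_pm} -> hash \notin X ->
  X ++ hash :: (plain b :: R) ++ flatten (unzip1 m2) <> flatten (unzip2 m2) ++ hist_fin.
Proof.
elim: m2 X R => [|m m2 IHm] X R hm hX /=.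
  case: X hX => [_ [] //|x X]; rewrite inE negb_or => /andP[/eqP hx _] [/esym] //.
have hm' : {subset m2 <= hist_pm} by move=> m' h; rewrite hm // in_cons h orbT.
case: (mem_hist_pm (hm _ (mem_head _ _))) => [[a aT ->]|[[p q] hpq ->]|[[p q] hpq ->]] /=.
- case: X hX => [|x X] //=; rewrite inE negb_or => /andP[_ hX] [_].
  by have := IHm X (rcons R (bar a)) hm' hX; rewrite /= cat_rcons.
- rewrite -catA => /(hash_prefix (hash_bar _))[X' eX e]; rewrite {}eX in hX.
  have hX' : hash \notin X' by move: hX; rewrite mem_cat negb_or => /andP[].
  by have := IHm X' (R ++ map bar p) hm' hX'; rewrite /= -catA e.
- case: X hX => [_|x X]; last by rewrite inE negb_or => /andP[/eqP hx _] [/esym].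
  have [q0 _] := rev_pairsP hpq; rewrite -catA.
  by case: q q0 {hpq}.
Qed.

(** As [hist_fin] contains one more [hash], the first stage has to write one. *)
Lemma history_count_hash m2 : {subset m2 <= hist_pm} ->
  count_mem hash (flatten (unzip1 m2)) = count_mem hash (flatten (unzip2 m2)).
Proof.
elim: m2 => //= m m2 IHm hm; rewrite !count_cat IHm; last first.
  by move=> m' h; rewrite hm // in_cons h orbT.
have cb x : count_mem hash (map bar x) = 0 by apply/count_memPn/hash_bar.
by case: (mem_hist_pm (hm _ (mem_head _ _))) => [[a aT ->]|[[p q] hpq ->]|[[p q] hpq ->]] /=;
  rewrite ?cb.
Qed.

Lemma hist_tm_split m1 : {subset m1 <= hist_tm} ->
  hash \notin flatten (unzip1 m1) \/
  exists ma mb, [/\ unzip2 m1 = ma ++ unzip2 mb, {subset mb <= hist_tm} &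
    flatten (unzip1 m1) = map plain ma ++ hash :: flatten (unzip1 mb)].
Proof.
elim: m1 => [|m m1 IHm] hm /=; first by left.
have hm' : {subset m1 <= hist_tm} by move=> m' h; rewrite hm // in_cons h orbT.
have := hm _ (mem_head _ _); rewrite mem_cat => /orP[]/mapP[a _ ->] /=.
  case: (IHm hm') => [h|[ma [mb [-> h ->]]]]; first by left; rewrite inE.
  by right; exists (a :: ma), mb.
by right; exists [:: a], m1.
Qed.

Lemma corr_history_sound w : corr_lang hist_tm hist_pm hist_fin w ->
  w != [::] /\ ps_lang G w.
Proof.
case=> m1 [m2 [h1 h2 e ew]].
case: (hist_tm_split h1) => [hn|[ma [mb [e1 hb e2]]]].
  move/(congr1 (count_mem hash)): e; rewrite !count_cat history_count_hash //.
  by rewrite (count_memPn hn) /=; lia.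
have hpl : hash \notin map plain ma by apply/mapP => -[].
rewrite e2 -catA cat_cons in e; case: mb => [|m mb] in e1 hb e2 e.
  rewrite /= cats0 in e1; have := @history_sound m2 (map plain ma) [::] h2 hpl e.
  have -> : map strip (map plain ma) = ma by rewrite -map_comp; elim: (ma) => //= a l ->.
  rewrite /= -e1 -ew => hd; split; last split=> //.
    rewrite ew e1; case: ma e2 {e e1 hpl} => [|a ma]; last first.
      by rewrite -size_eq0 size_rev.
    case: m1 h1 {ew} => //= m m1 h1; have := h1 _ (mem_head _ _).
    by rewrite mem_cat => /orP[]/mapP[a _ ->].
  apply/allP => a; rewrite ew mem_rev => /mapP[m /h1 + ->].
  by rewrite mem_cat => /orP[]/mapP[b hb' ->].
(* A further move after the first [hash] would put a plain letter right behind it. *)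
exfalso; have := hb _ (mem_head _ _); rewrite mem_cat => /orP[]/mapP[b _ em].
  by move: e; rewrite em /=; exact: history_plain_after_hash.
by move: e; rewrite em /=; exact: (@history_plain_after_hash _ _ b (hash :: _)).
Qed.

(** * Every derivation has a history *)

Definition history_solvable (x : word) : Prop :=
  exists2 m2, {subset m2 <= hist_pm} &
    hash :: map bar (rev x) ++ flatten (unzip1 m2) = flatten (unzip2 m2) ++ hist_fin.

Lemma copies_pm b : {subset b <= V} ->
  {subset [seq ([:: bar c], [:: bar c]) | c <- b] <= hist_pm}.
Proof.
move=> hb m /mapP[c /hb hc ->]; rewrite !mem_cat; apply/orP; right; apply/orP; left.
apply/mapP; exists ([:: c], [:: c]) => //; rewrite mem_cat; apply/orP; left.
by apply/mapP; exists c.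
Qed.

Lemma rev_pair_pm p q : (p, q) \in rev_pairs ->
  ((map bar p, map bar q) \in hist_pm) /\
  ((hash :: map bar p, hash :: map bar q) \in hist_pm).
Proof.
move=> h; rewrite !mem_cat; split.
  apply/orP; right; apply/orP; left; apply/mapP; by exists (p, q).
by do 2!(apply/orP; right); apply/mapP; exists (p, q).
Qed.

Lemma flatten_copies (b : word) :
  (flatten (unzip1 [seq ([:: bar c], [:: bar c]) | c <- b]) = map bar b) *
  (flatten (unzip2 [seq ([:: bar c], [:: bar c]) | c <- b]) = map bar b).
Proof. by split; elim: b => //= c b ->. Qed.

(** One pair applies the production and all other letters are copied. The first pair has to carry
    [hash]; it is the production itself if nothing precedes it, and a copy otherwise. *)
Lemma history_solvable_step x y : word_over V y -> y != [::] -> ps_step G x y ->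
  history_solvable x -> history_solvable y.
Proof.
move=> oy y0 /(rev_pairs_complete oy y0)[a [p [q [b [hpq ex ey]]]]] [m2 hm e].
rewrite {}ex in e.
have [hp1 hp2] := rev_pair_pm hpq.
have hV : {subset a ++ q ++ b <= V} by move=> c; rewrite -ey mem_rev; exact: (allP oy).
have hb : {subset b <= V} by move=> c hc; apply: hV; rewrite !mem_cat hc !orbT.
pose cp := fun b : word => [seq ([:: bar c], [:: bar c]) | c <- b].
have [m [hm' e1 e2]] : exists m, [/\ {subset m <= hist_pm},
    flatten (unzip1 m) = hash :: map bar (a ++ p ++ b) &
    flatten (unzip2 m) = hash :: map bar (a ++ q ++ b)].
  case: a hV {e ey} => [|c a] hV.
    exists ((hash :: map bar p, hash :: map bar q) :: cp b); split.
    - by move=> m; rewrite in_cons => /predU1P[->|/(copies_pm hb)].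
    - by rewrite /= flatten_copies map_cat.
    - by rewrite /= flatten_copies map_cat.
  have ha : {subset a <= V} by move=> d hd; apply: hV; rewrite in_cons mem_cat hd orbT.
  have hc : ([:: c], [:: c]) \in rev_pairs.
    by rewrite mem_cat; apply/orP; left; apply/mapP; exists c; rewrite // hV ?mem_head.
  have [_ hc2] := rev_pair_pm hc.
  exists (([:: hash; bar c], [:: hash; bar c]) :: cp a ++
     (map bar p, map bar q) :: cp b); split.
  - move=> m; rewrite in_cons mem_cat in_cons.
    by case/or4P=> [/eqP->|/(copies_pm ha)|/eqP->|/(copies_pm hb)].
  - by rewrite /unzip1 /= map_cat flatten_cat /= -!/(unzip1 _) !flatten_copies !map_cat.
  - by rewrite /unzip2 /= map_cat flatten_cat /= -!/(unzip2 _) !flatten_copies !map_cat.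
exists (m ++ m2).
  by move=> m'; rewrite mem_cat => /orP[/hm'|/hm].
by rewrite /unzip1 /unzip2 !map_cat !flatten_cat -!/(unzip1 _) -!/(unzip2 _) e1 e2 ey -catA -e.
Qed.

Lemma corr_history_complete w : w != [::] -> ps_lang G w ->
  corr_lang hist_tm hist_pm hist_fin w.
Proof.
case: wfG => hTV hS hP w0 [hT hd].
have SV : ps_S G \in V by move: hS; rewrite mem_filter => /andP[].
have : word_over V w /\ (w != [::] -> history_solvable w).
  (* The claim is restricted to nonempty forms. The induction goes through because a left-hand side
     contains a nonterminal, so the form before a step is never empty. *)
  apply: (clos_rt_invariant (I := fun w => word_over V w /\ (w != [::] -> history_solvable w)) _ hd).
    move=> x y [ox hx] st; have st' := st; case: st => -[u v] huv [a [b [ex ey]]].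
    have /and3P[_ hu hv] := allP hP _ huv.
    have oy : word_over V y.
      by move: ox; rewrite ex ey /word_over !all_cat => /and3P[-> _ ->]; rewrite andbT.
    split=> // y0; apply: (history_solvable_step oy y0 st'); apply: hx.
    by rewrite ex; case: (a) => //; case: u hu {hv huv st' ex ey}.
  split; first by rewrite /word_over /= SV.
  by move=> _; exists [::].
case=> _ /(_ w0)[m2 hm e].
have hrT : {subset rev w <= T} by move=> c; rewrite mem_rev; exact: (allP hT).
pose conv := [seq ([:: bar a], [:: plain a]) | a <- rev w].
have hconv : {subset conv <= hist_pm}.
  move=> m /mapP[a /hrT aT ->]; rewrite mem_cat; apply/orP; left.
  by apply/mapP; exists a.
have [m1 [h1 e1 e2]] : exists m1, [/\ {subset m1 <= hist_tm},
    flatten (unzip1 m1) = map plain (rev w) ++ [:: hash] & unzip2 m1 = rev w].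
  have rw0 : rev w != [::] by rewrite -size_eq0 size_rev size_eq0.
  case/lastP: (rev w) rw0 hrT => [//|r l _ hr].
  exists (rcons [seq ([:: plain a], a) | a <- r] ([:: plain l; hash], l)); split.
  - move=> m; rewrite mem_rcons in_cons mem_cat => /predU1P[->|/mapP[a ha ->]]; apply/orP.
      by right; apply/mapP; exists l; rewrite // hr // mem_rcons mem_head.
    by left; apply/mapP; exists a; rewrite // hr // mem_rcons in_cons ha orbT.
  - rewrite /unzip1 !map_rcons flatten_rcons cat_rcons; congr (_ ++ _).
    by elim: (r) => //= a r' ->.
  - by rewrite /unzip2 map_rcons -map_comp /= map_id.
exists m1, (conv ++ m2); split=> //; last by rewrite e2 revK.
  by move=> m'; rewrite mem_cat => /orP[/hconv|/hm].
rewrite e1 /unzip1 /unzip2 !map_cat !flatten_cat -!/(unzip1 _) -!/(unzip2 _).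
have -> : flatten (unzip1 conv) = map bar (rev w) by rewrite /conv; elim: (rev w) => //= c b ->.
have -> : flatten (unzip2 conv) = map plain (rev w) by rewrite /conv; elim: (rev w) => //= c b ->.
by rewrite -!catA -e.
Qed.

Lemma rev_pairs_over p q : (p, q) \in rev_pairs -> {subset p ++ q <= V}.
Proof.
case: wfG => _ _ hP.
have hP' u v : (u, v) \in ps_P G -> {subset rev u <= V} /\ {subset rev v <= V}.
  move=> /(allP hP)/and3P[/allP hu _ /allP hv].
  by split=> c; rewrite mem_rev; [exact: hu | exact: hv].
rewrite !mem_cat => /or4P[/mapP[c hc [-> ->]]|/mapP[[u v]]|/allpairsP[[[u v] c]]|/allpairsP[[[u v] c]]] /=.
- by move=> d; rewrite !inE orbb => /eqP->.
- rewrite mem_filter /= => /andP[_ /hP'[hu hv]] [-> ->] d.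
  by rewrite mem_cat => /orP[/hu|/hv].
- rewrite mem_filter /= => -[/andP[_ /hP'[hu _]] hc [-> ->]] d.
  by rewrite in_cons mem_cat inE => /or3P[/eqP->|/hu|/eqP->].
- rewrite mem_filter /= => -[/andP[_ /hP'[hu _]] hc [-> ->]] d.
  by rewrite mem_cat mem_rcons !inE => /orP[/orP[/eqP->|/hu]|/eqP->].
Qed.

Lemma ps_lang_in_SCM (L : language) : (forall w, L w <-> ps_lang G w) ->
  in_SCM 4 3 4 7 2 6 L.
Proof.
move=> hL; have [hTV hS hP] := wfG.
have SV : ps_S G \in V by move: hS; rewrite mem_filter => /andP[].
(* Membership of the empty word is settled classically, and the answer is built into the grammar. *)
have [eps heps] : exists eps : bool, eps <-> L [::].
  by case: (classic (L [::])) => h; [exists true | exists false].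
have hb x : {subset x <= V} -> {subset map bar x <= hist_toks}.
  by move=> hx t /mapP[c /hx hc ->]; rewrite in_cons mem_cat !map_f ?orbT.
have hh : hash \in hist_toks by rewrite mem_head.
apply: (@corr_lang_in_SCM tok hist_toks hist_tm hist_pm hist_fin T eps).
- move=> m; rewrite mem_cat => /orP[]/mapP[a aT ->] t; rewrite !inE.
    by move/eqP->; rewrite mem_cat map_f ?orbT.
  by case/orP=> /eqP-> //; rewrite mem_cat map_f ?orbT.
- by move=> m; rewrite mem_cat => /orP[]/mapP[a aT ->].
- by move=> m; rewrite mem_cat => /orP[]/mapP[a aT ->].
- move=> m /mem_hist_pm[[a aT ->]|[[p q] hpq ->]|[[p q] hpq ->]] t /=.
  + have aV := allP hTV _ aT.
    by rewrite !inE mem_cat => /orP[]/eqP->; rewrite map_f ?orbT.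
  + by rewrite -map_cat; apply: hb; exact: rev_pairs_over.
  + rewrite in_cons mem_cat in_cons.
    have := hb _ (rev_pairs_over hpq) t; rewrite map_cat mem_cat => h.
    by case/or4P=> [/eqP->|ht|/eqP->|ht] //; apply: h; rewrite ht ?orbT.
- move=> m /mem_hist_pm[[a aT ->]|[[p q] hpq ->]|[[p q] hpq ->]] //=.
  by have [q0 _] := rev_pairsP hpq; rewrite -size_eq0 size_map size_eq0.
- move=> t; rewrite !inE => /orP[/eqP->//|/eqP->].
  by rewrite mem_cat map_f ?orbT.
- by [].
- move=> w; case: (eqVneq w [::]) => [->|w0]; split.
  + by move/heps=> he; left.
  + by case=> [[/heps]|/corr_history_sound[]].
  + by move/hL => h; right; exact: corr_history_complete.
  + by case=> [[_ e]|/corr_history_sound[_ /hL]] //; rewrite e in w0.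
Qed.

End PhraseStructureToCorrespondence.

(** * Simulation of an SCM grammar by a type-0 grammar *)

Lemma cat_uniq_mid (T : Type) (P : pred T) (u v x y : seq T) (c d : T) :
  all (predC P) x -> all (predC P) y -> P c -> P d ->
  u ++ c :: v = x ++ d :: y -> [/\ u = x, c = d & v = y].
Proof.
move=> hx hy Pc Pd /esym e; case: (cat_eq_mid e) => [[t ex ev]|[t eu ev]] {e}.
  by move: hx; rewrite ex all_cat /= Pc andbF.
case: t eu ev => [|a t] eu /= [ec ev]; first by rewrite eu cats0.
by move: hy; rewrite ev all_cat /= Pc andbF.
Qed.

Lemma prefix_nested (T : eqType) (f y w : seq T) :
  prefix f w -> prefix y w -> size y <= size f -> prefix y f.
Proof.
elim: f y w => [|a f IHf] [|b y] [|c w] //= /andP[/eqP-> h1] /andP[/eqP-> h2] hs.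
by rewrite eqxx (IHf _ w).
Qed.

Section SCMToPhraseStructure.
Variable G : scm_grammar.
Hypothesis wfG : scm_wf G.

Local Notation V := (scm_V G).
Local Notation T := (scm_T G).
Local Notation derives := (clos_refl_trans _ (scm_step G)).

(* The machine scans the sentential form, written between [lbr] and [rbr], with
   one state symbol marking the head. *)
Definition lbr : symbol := (\max_(a <- V) a).+1.
Definition rbr : symbol := lbr.+1.
Definition state_code (k : nat) (r : matrix) : symbol := rbr.+1 + pickle (k, r).
(** Locked, so that comparing states does not unfold the [pickle] codes. *)
Definition state : nat -> matrix -> symbol := locked state_code.
Definition is_state (q : symbol) : bool := rbr < q.

Definition no_matrix : matrix := ([::], (None, None)).
Definition st_start := state 0 no_matrix.
Definition st_idle := state 1 no_matrix.
Definition st_end := state 2 no_matrix.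
Definition st_check (r : matrix) := state 3 r.
Definition st_scan (r : matrix) := state 4 r.
(** The rules still to be applied are packed into a matrix without conditions, so that all states
    share one encoding. *)
Definition st_apply (rs : seq (symbol * word)) := state 5 (rs, (None, None)).

Lemma state_inj k k' r r' : state k r = state k' r' -> k = k' /\ r = r'.
Proof.
by rewrite /state -lock => /addnI/(pcan_inj pickleK)-[-> ->].
Qed.

Lemma is_state_state k r : is_state (state k r).
Proof. by rewrite /is_state /state -lock /state_code; lia. Qed.

Definition moves (q : symbol) : seq (word * word) :=
  [seq ([:: c; q], [:: q; c]) | c <- V] ++ [seq ([:: q; c], [:: c; q]) | c <- V].

(* Words whose presence at the head shows that [f] does not occur there. *)
Definition windows (f : word) : seq word :=
  [seq y <- [seq rcons (take j f) c | j <- iota 0 (size f), c <- rcons V rbr] |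
     ~~ prefix y f && (head 0 y != rbr)].

Definition apply_rules (rs : seq (symbol * word)) : seq (word * word) :=
  moves (st_apply rs) ++
  match rs with
  | [::] => [:: ([:: st_apply rs], [:: st_idle])]
  | Ax :: rs' => [:: ([:: st_apply rs; Ax.1], st_apply rs' :: Ax.2)]
  end.

(** Reaching [st_check r] certifies the permitting word. The head must then return to [lbr], so that
    the scan for the forbidden word covers the whole form. *)
Definition matrix_rules (r : matrix) : seq (word * word) :=
  (st_idle :: odflt [::] (mP r), st_check r :: odflt [::] (mP r)) ::
  moves (st_check r) ++
  match mF r with
  | None => [:: ([:: lbr; st_check r], [:: lbr; st_apply (mrules r)])]
  | Some f =>
      ([:: lbr; st_check r], [:: lbr; st_scan r]) ::
      ([:: st_scan r; rbr], [:: st_apply (mrules r); rbr]) ::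
      [seq (st_scan r :: y, head 0 y :: st_scan r :: behead y) | y <- windows f]
  end ++
  flatten [seq apply_rules (drop i (mrules r)) | i <- iota 0 (size (mrules r)).+1].

Definition machine_rules : seq (word * word) :=
  [:: ([:: st_start], [:: lbr; st_idle; scm_S G; rbr]);
      ([:: lbr; st_idle], [:: st_end]); ([:: st_end; rbr], [::])] ++
  [seq ([:: st_end; a], [:: a; st_end]) | a <- T] ++
  moves st_idle ++ flatten (map matrix_rules (scm_M G)).

Definition machine : ps_grammar := {|
  ps_V := T ++ st_start :: flatten [seq uv.1 ++ uv.2 | uv <- machine_rules];
  ps_T := T;
  ps_S := st_start;
  ps_P := machine_rules |}.

Variant movable : symbol -> Prop :=
| MovableIdle : movable st_idle
| MovableCheck r of r \in scm_M G : movable (st_check r)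
| MovableApply rs : movable (st_apply rs).

(** Left-hand sides are split at their only state letter. In a configuration this letter is unique,
    which determines where a rule applies. *)
Variant machine_rule : word -> symbol -> word -> word -> Prop :=
| RuleStart : machine_rule [::] st_start [::] [:: lbr; st_idle; scm_S G; rbr]
| RuleExit : machine_rule [:: lbr] st_idle [::] [:: st_end]
| RuleErase : machine_rule [::] st_end [:: rbr] [::]
| RuleOut a of a \in T : machine_rule [::] st_end [:: a] [:: a; st_end]
| RuleLeft q c of movable q & c \in V : machine_rule [:: c] q [::] [:: q; c]
| RuleRight q c of movable q & c \in V : machine_rule [::] q [:: c] [:: c; q]
| RuleCheck r of r \in scm_M G : machine_rule [::] st_idle (odflt [::] (mP r))
    (st_check r :: odflt [::] (mP r))
| RuleNoScan r of r \in scm_M G & mF r = None :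
    machine_rule [:: lbr] (st_check r) [::] [:: lbr; st_apply (mrules r)]
| RuleScan r f of r \in scm_M G & mF r = Some f :
    machine_rule [:: lbr] (st_check r) [::] [:: lbr; st_scan r]
| RuleWindow r f y of r \in scm_M G & mF r = Some f & y \in windows f :
    machine_rule [::] (st_scan r) y (head 0 y :: st_scan r :: behead y)
| RuleScanned r f of r \in scm_M G & mF r = Some f :
    machine_rule [::] (st_scan r) [:: rbr] [:: st_apply (mrules r); rbr]
| RuleApply Ax rs : machine_rule [::] (st_apply (Ax :: rs)) [:: Ax.1] (st_apply rs :: Ax.2)
| RuleDone : machine_rule [::] (st_apply [::]) [::] [:: st_idle].

Lemma movesP q uv : uv \in moves q ->
  exists2 c, c \in V & uv = ([:: c; q], [:: q; c]) \/ uv = ([:: q; c], [:: c; q]).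
Proof.
by rewrite mem_cat => /orP[]/mapP[c hc ->]; exists c; [|left| |right].
Qed.

Lemma machine_rulesP uv : uv \in machine_rules ->
  exists l q r, uv.1 = l ++ q :: r /\ machine_rule l q r uv.2.
Proof.
have hmove q : movable q -> uv \in moves q ->
    exists l q' r, uv.1 = l ++ q' :: r /\ machine_rule l q' r uv.2.
  move=> hq /movesP[c hc [->|->]]; first by exists [:: c], q, [::]; split=> //; constructor.
  by exists [::], q, [:: c]; split=> //; constructor.
rewrite mem_cat !inE => /orP[/or3P[]/eqP->|].
- by exists [::], st_start, [::]; split=> //; constructor.
- by exists [:: lbr], st_idle, [::]; split=> //; constructor.
- by exists [::], st_end, [:: rbr]; split=> //; constructor.
rewrite mem_cat => /orP[/mapP[a ha ->]|].
  by exists [::], st_end, [:: a]; split=> //; constructor.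
rewrite mem_cat => /orP[/hmove|/flattenP[s /mapP[r hr ->]]]; first by apply; constructor.
rewrite in_cons mem_cat => /predU1P[->|/orP[/hmove|]].
- by exists [::], st_idle, (odflt [::] (mP r)); split=> //; exact: RuleCheck.
- by apply; constructor.
rewrite mem_cat => /orP[|/flattenP[s' /mapP[i _ ->]]]; last first.
  rewrite mem_cat => /orP[/hmove|]; first by apply; constructor.
  case: (drop i (mrules r)) => [|Ax rs]; rewrite inE => /eqP->.
    by exists [::], (st_apply [::]), [::]; split=> //; constructor.
  by exists [::], (st_apply (Ax :: rs)), [:: Ax.1]; split=> //; constructor.
case ef : (mF r) => [f|]; last first.
  rewrite inE => /eqP->; exists [:: lbr], (st_check r), [::].
  by split=> //; exact: RuleNoScan.
rewrite !in_cons => /or3P[/eqP->|/eqP->|/mapP[y hy ->]].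
- exists [:: lbr], (st_check r), [::]; split=> //; exact: RuleScan ef.
- exists [::], (st_scan r), [:: rbr]; split=> //; exact: RuleScanned ef.
- exists [::], (st_scan r), y; split=> //; exact: RuleWindow ef hy.
Qed.

Lemma V_lt a : a \in V -> a < lbr.
Proof. by move=> aV; rewrite ltnS; exact: leq_bigmax_seq. Qed.

Lemma T_V a : a \in T -> a \in V.
Proof. by case: wfG => _ [_ [/allP h _]]; exact: h. Qed.

Definition state_free (w : word) : bool := all (predC is_state) w.

Lemma state_free_V w : word_over V w -> state_free w.
Proof.
by apply: sub_all => a /V_lt; rewrite /= /is_state /rbr; lia.
Qed.

Lemma state_free_br : (is_state lbr = false) * (is_state rbr = false).
Proof. by rewrite /is_state /rbr; split; lia. Qed.

Lemma br_V w : word_over V w -> (lbr \notin w) * (rbr \notin w).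
Proof.
move/allP=> hw; split; apply/negP => /hw/V_lt; rewrite /rbr; lia.
Qed.

Lemma machine_rule_state l q r rhs : machine_rule l q r rhs -> is_state q.
Proof.
have hmov q' : movable q' -> is_state q' by case=> *; exact: is_state_state.
by case=> *; first [exact: is_state_state | exact: hmov].
Qed.

Lemma machine_step_inv u q v y : is_state q -> state_free u -> state_free v ->
  ps_step machine (u ++ q :: v) y ->
  exists l r rhs u0 v0, [/\ machine_rule l q r rhs, u = u0 ++ l, v = r ++ v0 &
    y = u0 ++ rhs ++ v0].
Proof.
move=> hq hu hv [[lhs rhs] /machine_rulesP[l [q' [r [/= -> h]]]] [a [b [e ->]]]].
have hq' := machine_rule_state h.
move: e; rewrite -catA cat_cons catA => /esym/(cat_uniq_mid hu hv hq' hq)[<- eq <-].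
by exists l, r, rhs, a, b; rewrite -eq.
Qed.

(** * Soundness of the machine *)

Definition reachable (w : word) : Prop :=
  word_over V w /\ derives [:: scm_S G] w.

Definition config (x : word) (q : symbol) (y : word) : word :=
  (lbr :: x) ++ q :: (y ++ [:: rbr]).

Definition P_holds (r : matrix) (w : word) : Prop := forall p, mP r = Some p -> infix p w.
Definition F_holds (r : matrix) (w : word) : Prop := forall f, mF r = Some f -> ~~ infix f w.

(** In [InvScan] no occurrence of [f] begins to the left of the head. In [InvApply], [w] is the form
    on which the conditions were tested and [ds] the rules applied since. [InvFinal] is without a
    state letter, hence without a step. *)
Inductive machine_inv : word -> Prop :=
| InvStart : machine_inv [:: st_start]
| InvIdle x y of reachable (x ++ y) : machine_inv (config x st_idle y)
| InvCheck r x y of r \in scm_M G & reachable (x ++ y) & P_holds r (x ++ y) :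
    machine_inv (config x (st_check r) y)
| InvScan r f x y of r \in scm_M G & mF r = Some f & reachable (x ++ y) &
    P_holds r (x ++ y) & (forall a b, x ++ y = a ++ f ++ b -> size x <= size a) :
    machine_inv (config x (st_scan r) y)
| InvApply r ds rs w x y of r \in scm_M G & mrules r = ds ++ rs & reachable w &
    P_holds r w & F_holds r w & rules_apply ds w (x ++ y) & word_over V (x ++ y) :
    machine_inv (config x (st_apply rs) y)
| InvEnd x y of reachable (x ++ y) & word_over T x :
    machine_inv (x ++ st_end :: y ++ [:: rbr])
| InvFinal w of reachable w & word_over T w : machine_inv w.

Lemma rules_apply_cat rs1 rs2 x y :
  rules_apply (rs1 ++ rs2) x y <->
  exists2 z, rules_apply rs1 x z & rules_apply rs2 z y.
Proof.
elim: rs1 x => [|r rs1 IH] x /=.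
  by split=> [h|[z -> //]]; exists x.
split=> [[z [h /IH[t h1 h2]]]|[t [z [h h1]] h2]]; first by exists t => //; exists z.
by exists z; split=> //; apply/IH; exists t.
Qed.

Lemma config_left c u x : c != lbr -> lbr :: x = u ++ [:: c] ->
  exists2 x', x = x' ++ [:: c] & u = lbr :: x'.
Proof.
move=> hc; case: u => [|b u] /= [e1 e2]; first by rewrite e1 eqxx in hc.
by exists u; rewrite // e1.
Qed.

Lemma config_right p v y : rbr \notin p -> y ++ [:: rbr] = p ++ v ->
  exists2 y', y = p ++ y' & v = y' ++ [:: rbr].
Proof.
move=> hp e; case: (cat_eq_mid (esym e)) => [[t ep _]|[t -> ->]]; last by exists t.
by rewrite ep mem_cat mem_head orbT in hp.
Qed.

Lemma config_lbr u x : lbr \notin x -> lbr :: x = u ++ [:: lbr] -> x = [::] /\ u = [::].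
Proof.
move=> hx; case: u => [[-> //]|b u [_ e]].
by rewrite e mem_cat mem_head orbT in hx.
Qed.

Lemma config_rbr v y : rbr \notin y -> y ++ [:: rbr] = rbr :: v -> y = [::] /\ v = [::].
Proof.
case: y => [|a y] /=; first by move=> _ [<-].
by rewrite inE negb_or => /andP[/eqP h _] [/esym/h].
Qed.

Lemma over_cat A x y : word_over A (x ++ y) = word_over A x && word_over A y.
Proof. exact: all_cat. Qed.

Lemma matrix_over r : r \in scm_M G ->
  [/\ all (fun Ax => word_over V Ax.2) (mrules r),
      (forall p, mP r = Some p -> word_over V p) &
      (forall f, mF r = Some f -> f != [::] /\ word_over V f)].
Proof.
case: wfG => _ [_ [_ [_ [_ [_ /allP h]]]]] /h /and4P[_ h1 h2 h3]; split.
- by apply: sub_all h1 => Ax /andP[].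
- by move=> p e; move: h2; rewrite e => /andP[].
- by move=> f e; move: h3; rewrite e => /andP[].
Qed.

Lemma state_free_config x y : word_over V (x ++ y) ->
  state_free (lbr :: x) /\ state_free (y ++ [:: rbr]).
Proof.
rewrite over_cat => /andP[/state_free_V hx /state_free_V hy].
split; first by rewrite /state_free /= state_free_br.
by rewrite /state_free all_cat /= state_free_br /= andbT.
Qed.

Definition move_shape (q : symbol) (l r rhs : word) : Prop :=
  exists2 c, c \in V &
    [/\ l = [:: c], r = [::] & rhs = [:: q; c]] \/
    [/\ l = [::], r = [:: c] & rhs = [:: c; q]].

Lemma moves_config x q y l r rhs u0 v0 : word_over V (x ++ y) ->
  lbr :: x = u0 ++ l -> y ++ [:: rbr] = r ++ v0 -> move_shape q l r rhs ->
  exists x' y', x' ++ y' = x ++ y /\ u0 ++ rhs ++ v0 = config x' q y'.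
Proof.
move=> hxy e1 e2 [c hc [[el er ->]|[el er ->]]]; move: e1 e2; rewrite {}el {}er.
  have clb : c != lbr by apply/eqP => e; move: (V_lt hc); rewrite e; lia.
  case/(config_left clb)=> x' -> -> /= <-.
  by exists x', (c :: y); rewrite -catA.
have crb : rbr \notin [:: c].
  by rewrite inE; apply/eqP => e; move: (V_lt hc); rewrite -e /rbr; lia.
rewrite cats0 => <- /(config_right crb)[y' -> ->].
by exists (x ++ [:: c]), y'; rewrite -catA /config /= -catA.
Qed.

Ltac by_state := let e := fresh in move=> e; solve [by case: (state_inj e)].

Lemma idle_rules l r rhs : machine_rule l st_idle r rhs ->
  [\/ move_shape st_idle l r rhs,
      [/\ l = [:: lbr], r = [::] & rhs = [:: st_end]] |
      exists m, [/\ m \in scm_M G, l = [::], r = odflt [::] (mP m) &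
        rhs = st_check m :: odflt [::] (mP m)]].
Proof.
move Eq : st_idle => q h; case: h Eq => {l q r rhs}; try by_state.
- by constructor 2.
- by move=> a _; by_state.
- by move=> q c _ hc <-; constructor 1; exists c => //; left.
- by move=> q c _ hc <-; constructor 1; exists c => //; right.
- by move=> m hm _; constructor 3; exists m.
- by move=> m hm _; by_state.
- by move=> m f hm _; by_state.
- by move=> m f y hm _ _; by_state.
- by move=> m f hm _; by_state.
- by move=> Ax rs; by_state.
Qed.

Lemma check_rules m l r rhs : machine_rule l (st_check m) r rhs ->
  [\/ move_shape (st_check m) l r rhs,
      [/\ mF m = None, l = [:: lbr], r = [::] & rhs = [:: lbr; st_apply (mrules m)]] |
      exists f, [/\ mF m = Some f, l = [:: lbr], r = [::] & rhs = [:: lbr; st_scan m]]].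
Proof.
move Eq : (st_check m) => q h; case: h Eq => {l q r rhs}; try by_state.
- by move=> a _; by_state.
- by move=> q c _ hc <-; constructor 1; exists c => //; left.
- by move=> q c _ hc <-; constructor 1; exists c => //; right.
- by move=> m' hm; by_state.
- by move=> m' _ e /state_inj[_ em]; constructor 2; rewrite em.
- by move=> m' f _ e /state_inj[_ em]; constructor 3; exists f; rewrite em.
- by move=> m' f y hm _ _; by_state.
- by move=> m' f hm _; by_state.
- by move=> Ax rs; by_state.
Qed.

Lemma scan_rules m l r rhs : machine_rule l (st_scan m) r rhs ->
  exists2 f, mF m = Some f & l = [::] /\
    ((r \in windows f /\ rhs = head 0 r :: st_scan m :: behead r) \/
     (r = [:: rbr] /\ rhs = [:: st_apply (mrules m); rbr])).
Proof.
have nmov q : movable q -> st_scan m <> q.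
  by case=> *; by_state.
move Eq : (st_scan m) => q h; case: h Eq => {l q r rhs}; try by_state.
- by move=> a _; by_state.
- by move=> q c /nmov.
- by move=> q c /nmov.
- by move=> m' hm; by_state.
- by move=> m' hm _; by_state.
- by move=> m' f hm _; by_state.
- move=> m' f y _ ef hy /state_inj[_ em]; rewrite em.
  by exists f => //; split=> //; left.
- move=> m' f _ ef /state_inj[_ em]; rewrite em.
  by exists f => //; split=> //; right.
- by move=> Ax rs; by_state.
Qed.

Lemma apply_rules_inv rs l r rhs : machine_rule l (st_apply rs) r rhs ->
  [\/ move_shape (st_apply rs) l r rhs,
      exists Ax rs', [/\ rs = Ax :: rs', l = [::], r = [:: Ax.1] &
        rhs = st_apply rs' :: Ax.2] |
      [/\ rs = [::], l = [::], r = [::] & rhs = [:: st_idle]]].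
Proof.
move Eq : (st_apply rs) => q h; case: h Eq => {l q r rhs}; try by_state.
- by move=> a _; by_state.
- by move=> q c _ hc <-; constructor 1; exists c => //; left.
- by move=> q c _ hc <-; constructor 1; exists c => //; right.
- by move=> m' hm; by_state.
- by move=> m' hm _; by_state.
- by move=> m' f hm _; by_state.
- by move=> m' f y hm _ _; by_state.
- by move=> m' f hm _; by_state.
- by move=> Ax rs' /state_inj[_ [->]]; constructor 2; exists Ax, rs'.
- by move/state_inj=> [_ [->]]; constructor 3.
Qed.

Lemma end_rules l r rhs : machine_rule l st_end r rhs ->
  l = [::] /\ ((r = [:: rbr] /\ rhs = [::]) \/
    exists2 a, a \in T & r = [:: a] /\ rhs = [:: a; st_end]).
Proof.
have nmov q : movable q -> st_end <> q.
  by case=> *; by_state.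
move Eq : st_end => q h; case: h Eq => {l q r rhs}; try by_state.
- by move=> _; split=> //; left.
- by move=> a aT _; split=> //; right; exists a.
- by move=> q c /nmov.
- by move=> q c /nmov.
- by move=> m' hm; by_state.
- by move=> m' hm _; by_state.
- by move=> m' f hm _; by_state.
- by move=> m' f y hm _ _; by_state.
- by move=> m' f hm _; by_state.
- by move=> Ax rs'; by_state.
Qed.

Lemma start_rules l r rhs : machine_rule l st_start r rhs ->
  [/\ l = [::], r = [::] & rhs = [:: lbr; st_idle; scm_S G; rbr]].
Proof.
have nmov q : movable q -> st_start <> q.
  by case=> *; by_state.
move Eq : st_start => q h; case: h Eq => {l q r rhs}; try by_state.
- by move=> a _; by_state.
- by move=> q c /nmov.
- by move=> q c /nmov.
- by move=> m' hm; by_state.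
- by move=> m' hm _; by_state.
- by move=> m' f hm _; by_state.
- by move=> m' f y hm _ _; by_state.
- by move=> m' f hm _; by_state.
- by move=> Ax rs'; by_state.
Qed.

Lemma rule_step_over Ax x y : word_over V Ax.2 -> rule_step Ax x y ->
  word_over V x -> word_over V y.
Proof.
move=> h [u [v [-> ->]]]; rewrite !over_cat /= h => /andP[-> /andP[_ ->]].
by [].
Qed.

Lemma scm_S_V : scm_S G \in V.
Proof. by case: wfG => _ [_ [_ [_ [+ _]]]]; rewrite mem_filter => /andP[]. Qed.

Lemma windowsP f y : y \in windows f ->
  [/\ ~~ prefix y f, head 0 y != rbr, y != [::] &
     exists j c, [/\ j < size f, c \in rcons V rbr & y = rcons (take j f) c]].
Proof.
rewrite mem_filter => /andP[/andP[h1 h2]] /allpairsP[[j c] [/= hj hc e]].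
split=> //; first by rewrite e; case: take.
by exists j, c; split=> //; move: hj; rewrite mem_iota.
Qed.

Lemma reachable_step r w w' : r \in scm_M G -> reachable w -> P_holds r w ->
  F_holds r w -> rules_apply (mrules r) w w' -> word_over V w' -> reachable w'.
Proof.
move=> hr [_ hd] hP hF ha hV; split=> //.
by apply: rt_trans hd (rt_step _ _ _ _ _); exists r.
Qed.

Lemma machine_inv_step x y : machine_inv x -> ps_step machine x y -> machine_inv y.
Proof.
have sS := is_state_state; case=> {x}.
- move/(@machine_step_inv [::] _ [::] _ (sS _ _) isT isT)=> [l [r [rhs [u0 [v0 [h]]]]]].
  have [-> -> ->] := start_rules h.
  case: u0 => //= _ <- ->; apply: (@InvIdle [::] [:: scm_S G]).
  by split; [rewrite /word_over /= scm_S_V | exact: rt_refl].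
- move=> x z hr; have hxz := hr.1; have [fx fz] := state_free_config hxz.
  case/(machine_step_inv (sS _ _) fx fz)=> l [r [rhs [u0 [v0 [h e1 e2 ->]]]]].
  case: (idle_rules h) => [hm|[el er ->]|[m [hm el er ->]]].
  + by have [x' [z' [e ->]]] := moves_config hxz e1 e2 hm; apply: InvIdle; rewrite e.
  + rewrite el in e1; rewrite er /= in e2; move: hxz; rewrite over_cat => /andP[/br_V[lx _] _].
    case: (config_lbr lx e1) => ex ->; rewrite -e2.
    by apply: (@InvEnd [::] z) => //; rewrite ex in hr.
  + have [_ hp _] := matrix_over hm.
    have hpV : word_over V (odflt [::] (mP m)) by case: (mP m) hp => //= p; apply.
    rewrite er in e2; rewrite el cats0 in e1; rewrite -e1.
    case: (config_right (br_V hpV).2 e2) => z' ez ->.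
    rewrite -[_ ++ _ :: _ ++ _]/(_ ++ _ :: _) cat_cons catA -ez; apply: InvCheck => //.
    by move=> p ep; rewrite ez ep /= infix_infix.
- move=> m x z hm hr hP; have hxz := hr.1; have [fx fz] := state_free_config hxz.
  case/(machine_step_inv (sS _ _) fx fz)=> l [r [rhs [u0 [v0 [h e1 e2 ->]]]]].
  case: (check_rules h) => [hs|[ef el er ->]|[f [ef el er ->]]].
  + by have [x' [z' [e ->]]] := moves_config hxz e1 e2 hs; apply: InvCheck; rewrite ?e.
  + rewrite el in e1; rewrite er /= in e2; move: (hxz); rewrite over_cat => /andP[/br_V[lx _] _].
    case: (config_lbr lx e1) => ex ->; rewrite -e2 ex in hr hxz hP *.
    apply: (@InvApply m [::] (mrules m) z [::] z) => //.
    by move=> f; rewrite ef.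
  + rewrite el in e1; rewrite er /= in e2; move: (hxz); rewrite over_cat => /andP[/br_V[lx _] _].
    case: (config_lbr lx e1) => ex ->; rewrite -e2 ex in hr hxz hP *.
    exact: (@InvScan m f [::] z).
- move=> m f x z hm ef hr hP hocc; have hxz := hr.1; have [fx fz] := state_free_config hxz.
  case/(machine_step_inv (sS _ _) fx fz)=> l [r [rhs [u0 [v0 [h e1 e2 ->]]]]].
  have [_ _ /(_ _ ef)[f0 fV]] := matrix_over hm.
  move: (hxz); rewrite over_cat => /andP[_ zV].
  case: (scan_rules h) => f'; rewrite ef => -[<-] [el] [[hw ->]|[er ->]]; rewrite el cats0 in e1;
    rewrite -e1.
  + case: (windowsP hw) => hpre hhd r0 [j [c [hj _ er]]].
    case: z e2 hr hP hocc hxz fz zV => [|b z].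
      by case: r r0 hhd {h hw hpre er} => //= b r _ /eqP hb [/esym/hb].
    case: r r0 er hpre hhd {h hw} => //= b' r _ er hpre _ [eb ez] hr hP hocc hxz fz zV.
    rewrite -eb -ez.
    suff : machine_inv (config (x ++ [:: b]) (st_scan m) z) by rewrite /config -cat_cons -catA.
    apply: (@InvScan m f) => //; rewrite -?catA //.
    (* An occurrence of [f] beginning at the head would have the window as a prefix, as a window is
       not longer than [f]; but windows are not prefixes of [f]. *)
    move=> a t e; have := hocc _ _ e; rewrite size_cat /= addn1 leq_eqVlt => /orP[/eqP es|//].
    exfalso; move: e => /eqP; rewrite eqseq_cat // => /andP[_ /eqP e].
    move: hpre; rewrite -eb => /negP; apply.
    have hpf : prefix f (b :: z ++ [:: rbr]) by rewrite -[b :: _]/(([:: b] ++ z) ++ [:: rbr]) e -catA prefix_prefix.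
    have hpr : prefix (b :: r) (b :: z ++ [:: rbr]) by rewrite ez -cat_cons prefix_prefix.
    have sz : size (b :: r) <= size f by rewrite eb er size_rcons size_takel //; lia.
    exact: prefix_nested hpf hpr sz.
  + rewrite er in e2; case: (config_rbr (br_V zV).2 e2) => ez ->.
    rewrite ez cats0 in hr hP hocc hxz.
    rewrite -[(lbr :: x) ++ _]/(config x (st_apply (mrules m)) [::]).
    apply: (@InvApply m [::] (mrules m) x) => //; rewrite ?cats0 //.
    (* With the head at the right end, a nonempty [f] has no room after it. *)
    move=> f''; rewrite ef => -[<-]; apply/negP => /infixP[a [t e]].
    have := hocc a t e; rewrite e !size_cat; case: f f0 {e hocc ef fV h} => //= *; lia.
- move=> m ds rs w x z hm ers hr hP hF ha hxz; have [fx fz] := state_free_config hxz.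
  case/(machine_step_inv (sS _ _) fx fz)=> l [r [rhs [u0 [v0 [h e1 e2 ->]]]]].
  have [hV _ _] := matrix_over hm.
  case: (apply_rules_inv h) => [hs|[Ax [rs' [erl el er ->]]]|[erl el er ->]].
  + have [x' [z' [e ->]]] := moves_config hxz e1 e2 hs.
    by apply: (InvApply hm ers hr hP hF); rewrite e.
  + move: hV; rewrite ers erl all_cat /= => /and3P[_ hA _].
    rewrite er in e2; rewrite el cats0 in e1; rewrite -e1.
    have hst t : z = Ax.1 :: t -> rule_step Ax (x ++ z) (x ++ Ax.2 ++ t).
      by move=> ->; exists x, t.
    have AV : rbr \notin [:: Ax.1].
      case: wfG => _ [_ [_ [_ [_ [_ /allP hwf]]]]].
      have := hwf _ hm; case/and4P=> _ + _ _; rewrite ers erl all_cat /= => /and3P[_ /andP[+ _] _].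
      rewrite mem_filter => /andP[_ hAV]; apply: (br_V _).2.
      by rewrite /word_over /= hAV.
    case: (config_right AV e2) => t ez ->; have ht := hst _ ez.
    have hxt := rule_step_over hA ht hxz.
    have -> : (lbr :: x) ++ (st_apply rs' :: Ax.2) ++ t ++ [:: rbr] =
       config x (st_apply rs') (Ax.2 ++ t) by rewrite /config cat_cons -catA.
    apply: (@InvApply m (rcons ds Ax) rs' w) => //; first by rewrite cat_rcons -erl.
    rewrite -cats1; apply/rules_apply_cat; exists (x ++ z) => //.
    by exists (x ++ Ax.2 ++ t).
  + rewrite er /= in e2; rewrite el cats0 in e1; rewrite -e1 -e2; apply: InvIdle.
    apply: (reachable_step hm hr hP hF) hxz.
    by rewrite ers erl cats0.
- move=> x z hr xT; have hxz := hr.1; have [fx fz] := state_free_config hxz.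
  have fx' : state_free x by move: fx; rewrite /state_free /= state_free_br.
  case/(machine_step_inv (sS _ _) fx' fz)=> l [r [rhs [u0 [v0 [h e1 e2 ->]]]]].
  move: (hxz); rewrite over_cat => /andP[_ zV].
  case: (end_rules h) => el [[er ->]|[a aT [er ->]]]; rewrite el cats0 in e1; rewrite -e1.
  + rewrite er in e2; case: (config_rbr (br_V zV).2 e2) => ez ->.
    rewrite !cats0; rewrite ez cats0 in hr.
    exact: InvFinal.
  + have aV : rbr \notin [:: a] by apply: (br_V _).2; rewrite /word_over /= T_V.
    rewrite er in e2; case: (config_right aV e2) => t ez ->.
    have -> : x ++ [:: a; st_end] ++ t ++ [:: rbr] = (x ++ [:: a]) ++ st_end :: t ++ [:: rbr].
      by rewrite -catA.
    apply: InvEnd; first by rewrite -catA; rewrite ez in hr.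
    by rewrite over_cat xT /word_over /= aT.
- move=> w [wV _] _ [[lhs rhs] /machine_rulesP[l [q [r [/= -> h]]]] [a [b [e _]]]].
  have hq := machine_rule_state h.
  have := allP (state_free_V wV) q; rewrite e !mem_cat in_cons eqxx !orbT /= hq.
  by move/(_ isT).
Qed.

Lemma machine_lang_sound w : ps_lang machine w -> scm_lang G w.
Proof.
case=> hT hd; split=> //.
have TV : word_over V w by apply: sub_all hT => a; exact: T_V.
have hinv := clos_rt_invariant machine_inv_step hd InvStart.
have notst u q v : is_state q -> w <> u ++ q :: v.
  move=> hq e; have := state_free_V TV.
  by rewrite e /state_free all_cat /= hq andbF.
case: hinv notst => {hT hd TV}.
- by move=> /(_ [::] _ [::] (is_state_state 0 no_matrix) erefl).
- by move=> x y _ /(_ (lbr :: x) _ (y ++ [:: rbr]) (is_state_state 1 no_matrix) erefl).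
- by move=> r x y _ _ _ /(_ (lbr :: x) _ (y ++ [:: rbr]) (is_state_state 3 r) erefl).
- by move=> r f x y _ _ _ _ _ /(_ (lbr :: x) _ (y ++ [:: rbr]) (is_state_state 4 r) erefl).
- move=> r ds rs w' x y _ _ _ _ _ _ _ /(_ (lbr :: x) _ (y ++ [:: rbr])).
  by move/(_ _ (is_state_state 5 (rs, (None, None))) erefl).
- by move=> x y _ _ /(_ x _ (y ++ [:: rbr]) (is_state_state 2 no_matrix) erefl).
- by move=> w' [_ h].
Qed.

(** * Completeness of the machine *)

Local Notation mderives := (clos_refl_trans _ (ps_step machine)).

Ltac cat_right := rewrite mem_cat; apply/orP; right.
Ltac cat_left := rewrite mem_cat; apply/orP; left.
Ltac cons_right := rewrite in_cons; apply/orP; right.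

Lemma machine_step lhs rhs x y : (lhs, rhs) \in machine_rules ->
  mderives (x ++ lhs ++ y) (x ++ rhs ++ y).
Proof. by move=> h; apply: rt_step; exists (lhs, rhs) => //; exists x, y. Qed.

Lemma mem_matrix_rules r uv : r \in scm_M G -> uv \in matrix_rules r ->
  uv \in machine_rules.
Proof.
move=> hr h; do 3!cat_right.
by apply/flattenP; exists (matrix_rules r) => //; apply/mapP; exists r.
Qed.

Lemma mem_apply_rules r ds rs uv : r \in scm_M G -> mrules r = ds ++ rs ->
  uv \in apply_rules rs -> uv \in machine_rules.
Proof.
move=> hr e h; apply: (mem_matrix_rules hr); cons_right; do 2!cat_right; apply/flattenP; exists (apply_rules rs) => //.
apply/mapP; exists (size ds); last by rewrite e drop_size_cat.
by rewrite mem_iota e size_cat; lia.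
Qed.

Lemma move_right q u x v : {subset moves q <= machine_rules} -> word_over V x ->
  mderives (u ++ q :: x ++ v) (u ++ x ++ q :: v).
Proof.
move=> hq; elim: x u => [|c x IHx] u /=; first by move=> _; exact: rt_refl.
case/andP=> hc hx; apply: rt_trans (machine_step u (x ++ v) (hq ([:: q; c], [:: c; q]) _)) _.
  by rewrite mem_cat; apply/orP; right; apply/mapP; exists c.
by have := IHx (u ++ [:: c]) hx; rewrite -!catA.
Qed.

Lemma move_left q u x v : {subset moves q <= machine_rules} -> word_over V x ->
  mderives (u ++ x ++ q :: v) (u ++ q :: x ++ v).
Proof.
move=> hq; elim: x u => [|c x IHx] u /=; first by move=> _; exact: rt_refl.
case/andP=> hc hx.
have := IHx (u ++ [:: c]) hx; rewrite -!catA /= => h; apply: rt_trans h _.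
apply: (machine_step u (x ++ v) (hq ([:: c; q], [:: q; c]) _)).
by rewrite mem_cat; apply/orP; left; apply/mapP; exists c.
Qed.

Lemma moves_idle : {subset moves st_idle <= machine_rules}.
Proof.
by move=> uv h; do 2!cat_right; cat_left.
Qed.

Lemma moves_check r : r \in scm_M G -> {subset moves (st_check r) <= machine_rules}.
Proof.
by move=> hr uv h; apply: (mem_matrix_rules hr); cons_right; cat_left.
Qed.

Lemma moves_apply r ds rs : r \in scm_M G -> mrules r = ds ++ rs ->
  {subset moves (st_apply rs) <= machine_rules}.
Proof.
by move=> hr e uv h; apply: (mem_apply_rules hr e); rewrite mem_cat h.
Qed.

Lemma config_move_left q x y z : {subset moves q <= machine_rules} -> word_over V x ->
  mderives (config (z ++ x) q y) (config z q (x ++ y)).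
Proof.
move=> hq hx; have := @move_left q (lbr :: z) x (y ++ [:: rbr]) hq hx.
by rewrite /config /= -!catA.
Qed.

Lemma config_move_right q x y z : {subset moves q <= machine_rules} -> word_over V x ->
  mderives (config z q (x ++ y)) (config (z ++ x) q y).
Proof.
move=> hq hx; have := @move_right q (lbr :: z) x (y ++ [:: rbr]) hq hx.
by rewrite /config /= -!catA.
Qed.

Lemma check_complete r w : r \in scm_M G -> word_over V w -> P_holds r w ->
  mderives (config [::] st_idle w) (config [::] (st_check r) w).
Proof.
move=> hr hw hP; have [a [b ew]] : exists a b, w = a ++ odflt [::] (mP r) ++ b.
  case eP : (mP r) => [p|]; last by exists [::], w.
  by have /infixP[a [b ->]] := hP _ eP; exists a, b.
move: hw; rewrite ew over_cat => /andP[ha hb].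
apply: rt_trans (config_move_right _ [::] moves_idle ha) _.
apply: rt_trans (config_move_left _ [::] (moves_check hr) ha).
rewrite /config -!catA.
apply: (machine_step (lbr :: a) (b ++ [:: rbr])
  (lhs := st_idle :: odflt [::] (mP r)) (rhs := st_check r :: odflt [::] (mP r))).
by apply: (mem_matrix_rules hr); rewrite mem_head.
Qed.

(** The window ends at the first mismatch between [f] and [s ++ [:: rbr]]. If [s] is a proper prefix
    of [f], the mismatch is at [rbr], which does not occur in [f]. *)
Lemma window_exists f s : ~~ prefix f s -> rbr \notin f ->
  exists j c t, [/\ j < size f, s ++ [:: rbr] = take j f ++ c :: t,
    ~~ prefix (rcons (take j f) c) f & c \in rcons s rbr].
Proof.
elim: f s => [|a f IHf] s; first by rewrite prefix0s.
rewrite in_cons negb_or => + /andP[ha hf].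
case: s => [|b s] /=.
  move=> _; exists 0, rbr, [::]; split=> //; last by rewrite mem_head.
  by rewrite /= (negbTE ha).
case: (eqVneq a b) => [<-|ab] /=.
  case/(IHf _)/(_ hf)=> j [c [t [hj e hp hc]]].
  exists j.+1, c, t; split=> //=; first by rewrite e.
    by rewrite eqxx.
  by rewrite in_cons hc orbT.
move=> _; exists 0, b, (s ++ [:: rbr]); split=> //=; last by rewrite mem_head.
by rewrite eq_sym (negbTE ab).
Qed.

Lemma scan_complete r f x y : r \in scm_M G -> mF r = Some f -> word_over V y ->
  ~~ infix f y -> mderives (config x (st_scan r) y) (config (x ++ y) (st_scan r) [::]).
Proof.
move=> hr ef; have [_ _ /(_ _ ef)[f0 fV]] := matrix_over hr.
elim: y x => [|b y IHy] x; first by move=> _ _; rewrite cats0; exact: rt_refl.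
move=> hby; have /andP[hb hy] := hby; rewrite infix_consl negb_or => /andP[hp hi].
have [j [c [t [hj e hpre hc]]]] := window_exists hp (br_V fV).2.
have h1 : head 0 (rcons (take j f) c) = b.
  by move: e; rewrite -cat_rcons; case: (rcons _ _) (size_rcons (take j f) c) => //= d l _ [].
have h2 : y ++ [:: rbr] = behead (rcons (take j f) c) ++ t.
  by move: e; rewrite -cat_rcons; case: (rcons _ _) (size_rcons (take j f) c) => //= d l _ [].
have hst := @machine_step (st_scan r :: rcons (take j f) c)
  (head 0 (rcons (take j f) c) :: st_scan r :: behead (rcons (take j f) c)) (lbr :: x) t.
have -> : config x (st_scan r) (b :: y) =
    (lbr :: x) ++ (st_scan r :: rcons (take j f) c) ++ t.
  by rewrite /config e -(cat_rcons c).
apply: rt_trans (hst _) _.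
  apply: (mem_matrix_rules hr); cons_right; cat_right; cat_left.
  rewrite ef; do 2!cons_right.
  apply/mapP; exists (rcons (take j f) c) => //; rewrite mem_filter hpre h1.
  apply/andP; split.
    by apply/eqP => eb; have := (br_V hby).2; rewrite -eb mem_head.
  apply/allpairsP; exists (j, c); split; rewrite ?mem_iota //=.
  move: hc; rewrite !mem_rcons !in_cons => /orP[->//|hc].
  by rewrite [in X in _ || X](allP hby) ?orbT // in_cons.
have -> : (lbr :: x) ++ (head 0 (rcons (take j f) c) :: st_scan r ::
    behead (rcons (take j f) c)) ++ t = config (x ++ [:: b]) (st_scan r) y.
  by rewrite /config h1 h2 /= -catA.
by have := IHy (x ++ [:: b]) hy hi; rewrite -catA.
Qed.

Lemma forbid_complete r w : r \in scm_M G -> word_over V w -> F_holds r w ->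
  mderives (config [::] (st_check r) w) (config [::] (st_apply (mrules r)) w).
Proof.
move=> hr hw hF; have hap := @moves_apply r [::] _ hr erefl.
case ef : (mF r) => [f|]; last first.
  apply: (machine_step [::] (w ++ [:: rbr]) (lhs := [:: lbr; st_check r])
    (rhs := [:: lbr; st_apply (mrules r)])).
  apply: (mem_matrix_rules hr); cons_right; cat_right; cat_left.
  by rewrite ef mem_head.
apply: (rt_trans _ _ _ (config [::] (st_scan r) w)).
  apply: (machine_step [::] (w ++ [:: rbr]) (lhs := [:: lbr; st_check r])
    (rhs := [:: lbr; st_scan r])).
  apply: (mem_matrix_rules hr); cons_right; cat_right; cat_left.
  by rewrite ef mem_head.
apply: rt_trans (scan_complete [::] hr ef hw (hF _ ef)) _.
apply: (rt_trans _ _ _ (config w (st_apply (mrules r)) [::])); last first.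
  by have := config_move_left [::] [::] hap hw; rewrite cats0.
apply: (machine_step (lbr :: w) [::] (lhs := [:: st_scan r; rbr])
    (rhs := [:: st_apply (mrules r); rbr])).
apply: (mem_matrix_rules hr); cons_right; cat_right; cat_left.
by rewrite ef; cons_right; rewrite mem_head.
Qed.

Lemma apply_complete r ds rs w w' : r \in scm_M G -> mrules r = ds ++ rs ->
  word_over V w -> rules_apply rs w w' ->
  word_over V w' /\ mderives (config [::] (st_apply rs) w) (config [::] st_idle w').
Proof.
move=> hr; have [hall _ _] := matrix_over hr.
elim: rs ds w => [|Ax rs IHrs] ds w e hw /=.
  move=> <-; split=> //.
  apply: (machine_step [:: lbr] (w ++ [:: rbr]) (lhs := [:: st_apply [::]])
    (rhs := [:: st_idle])).
  by apply: (mem_apply_rules hr e); rewrite mem_cat mem_head orbT.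
case=> z [hz hrs].
have hA : word_over V Ax.2 by move: hall; rewrite e all_cat => /and3P[].
have zV := rule_step_over hA hz hw.
have e' : mrules r = rcons ds Ax ++ rs by rewrite cat_rcons.
have [hw' hd] := IHrs _ _ e' zV hrs; split=> //; apply: rt_trans hd.
case: hz => u [v [ew ez]].
have hu : word_over V u by move: hw; rewrite ew over_cat => /andP[].
rewrite ew ez; apply: rt_trans (config_move_right _ [::] (moves_apply hr e) hu) _.
apply: rt_trans (config_move_left _ [::] (moves_apply hr e') hu).
rewrite /config -!catA.
apply: (machine_step (lbr :: u) (v ++ [:: rbr]) (lhs := [:: st_apply (Ax :: rs); Ax.1])
  (rhs := st_apply rs :: Ax.2)).
by apply: (mem_apply_rules hr e); rewrite mem_cat mem_head orbT.
Qed.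

Lemma machine_lang_complete w : scm_lang G w -> ps_lang machine w.
Proof.
case=> hT hd; split=> //.
have [wV hc] : word_over V w /\ mderives [:: st_start] (config [::] st_idle w).
  apply: (clos_rt_invariant (I := fun w => word_over V w /\
    mderives [:: st_start] (config [::] st_idle w)) _ hd).
    move=> x y [xV hx] [r hr [hP hF ha]].
    have [yV hy] := @apply_complete r [::] _ _ _ hr erefl xV ha; split=> //.
    apply: rt_trans hx _; apply: rt_trans (check_complete hr xV hP) _.
    exact: rt_trans (forbid_complete hr xV hF) hy.
  split; first by rewrite /word_over /= scm_S_V.
  apply: (machine_step [::] [::] (lhs := [:: st_start])
    (rhs := [:: lbr; st_idle; scm_S G; rbr])).
  by rewrite mem_head.
apply: rt_trans hc _; apply: (rt_trans _ _ _ (st_end :: w ++ [:: rbr])).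
  apply: (machine_step [::] (w ++ [:: rbr]) (lhs := [:: lbr; st_idle]) (rhs := [:: st_end])).
  by rewrite mem_cat !in_cons eqxx !orbT.
apply: (rt_trans _ _ _ (w ++ [:: st_end; rbr])).
  have : forall u v, word_over T v ->
      mderives (u ++ st_end :: v ++ [:: rbr]) (u ++ v ++ [:: st_end; rbr]).
    move=> u v; elim: v u => [|a v IHv] u /=; first by move=> _; exact: rt_refl.
    case/andP=> ha hv.
    apply: rt_trans (machine_step u (v ++ [:: rbr]) (lhs := [:: st_end; a]) (rhs := [:: a; st_end]) _) _.
      by cat_right; cat_left; apply/mapP; exists a.
    by have := IHv (u ++ [:: a]) hv; rewrite -!catA.
  by move/(_ [::] w hT).
rewrite -[X in mderives _ X]cats0 -[X in mderives _ (_ ++ X)]cats0.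
apply: (machine_step w [::] (lhs := [:: st_end; rbr]) (rhs := [::])).
by rewrite mem_cat !in_cons eqxx !orbT.
Qed.

Lemma state_T q : is_state q -> q \notin T.
Proof.
by move=> hq; apply/negP => /T_V/V_lt; move: hq; rewrite /is_state /rbr; lia.
Qed.

Lemma machine_wf : ps_wf machine.
Proof.
split.
- by apply/allP => a aT; rewrite mem_cat aT.
- by rewrite mem_filter state_T ?is_state_state // mem_cat mem_head orbT.
apply/allP => uv huv.
have hV : {subset uv.1 ++ uv.2 <= ps_V machine}.
  move=> a ha; rewrite mem_cat in_cons; do 2!(apply/orP; right).
  by apply/flattenP; exists (uv.1 ++ uv.2) => //; apply/mapP; exists uv.
apply/and3P; split; try by apply/allP => a ha; apply: hV; rewrite mem_cat ha ?orbT.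
have [l [q [r [e h]]]] := machine_rulesP huv; apply/hasP; exists q.
  by rewrite e mem_cat mem_head orbT.
rewrite mem_filter state_T ?(machine_rule_state h) //=.
by apply: hV; rewrite e !mem_cat mem_head !orbT.
Qed.

End SCMToPhraseStructure.

Theorem mainTheorem4 (L : language) : in_SCM 4 3 4 7 2 6 L <-> is_RE L.
Proof.
split=> [[G [wfG [_ [_ [_ [_ [_ hL]]]]]]]|[G [wfG hL]]]; last exact: ps_lang_in_SCM hL.
exists (machine G); split; first exact: machine_wf.
move=> w; rewrite hL; split; first exact: machine_lang_complete.
exact: machine_lang_sound.
Qed.
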